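(* There exists a non-decreasing function $L:(0,1)\to[2,\infty)$ with $L(t)=2$ for all $0<t\le1/2$ such that the following holds. Let $\mathbf{d}=\{d_n\}_{n=1}^\infty\in\mathcal{D}$ and $T=4$, and suppose that $\mathcal{F}=\mathcal{F}(\mathbf{d},4)$ is a CIFS and $\mathcal{G}=\mathcal{G}(\mathbf{d},4)$ is a regular CIFS. If $h_{\mathcal{G}}:=\dim_H(J_{\mathcal{G}})\in(0,1)$ and $d_1\ge L(h_{\mathcal{G}})$, then $\dim_H(J_{\mathcal{F}})>\dim_H(J_{\mathcal{G}})$.
   Context: Notation. $\mathbb{N}$ is the set of positive integers, $\mathbb{D}=\{z\in\mathbb{C}:|z|<1\}$, $\mathbb{C}$ is identified with $\mathbb{R}^2$, $e(\theta)=e^{2\pi\sqrt{-1}\,\theta}$. $\dim_H$ is Hausdorff dimension. CIFS. Let $X\subset\mathbb{R}^d$ be compact and connected and $I$ a countable (possibly finite) set with at least two elements. A family $\mathcal{S}=\{s_i:X\to X\}_{i\in I}$ of injective contractions is an IFS if $\sup_{i}\mathrm{Lip}(s_i)<1$. For $\omega=(\omega_1,\dots,\omega_N)\in I^N$ put $s_\omega=s_{\omega_1}\circ\dots\circ s_{\omega_N}$. The limit set is $J_{\mathcal{S}}=\bigcup_{\omega\in I^{\mathbb{N}}}\bigcap_{N\ge1}s_{\omega|_N}(X)$, where $\omega|_N=(\omega_1,\dots,\omega_N)$. An IFS $\mathcal{S}$ is a conformal IFS (CIFS) if: (Open Set Condition) $s_i(\mathrm{Int}\,X)\cap s_j(\mathrm{Int}\,X)=\emptyset$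 for $i\ne j$; (Cone Condition) there are $0<\alpha<\pi/2$, $l>0$ such that for every $x\in\partial X$ there is $u_x\neq0$ with $\{y:0<|y-x|<l,\ \langle y-x,u_x\rangle>|y-x||u_x|\cos\alpha\}\subset\mathrm{Int}(X)$; (Conformality) there is an open connected $V\supset X$ such that all $s_i$ extend to $C^{1+\varepsilon}$ diffeomorphisms on $V$ that are conformal on $V$; (Bounded Distortion) there is $K\ge1$ with $|s_\omega'(y)|\le K|s_\omega'(x)|$ for all $\omega\in\bigcup_N I^N$, $x,y\in V$, where $|s'_\omega(x)|$ is the operator norm of the derivative. Pressure and regularity. For a CIFS, $P_{\mathcal{S}}(t)=\lim_{N\to\infty}\frac1N\log\sum_{\omega\in I^N}\sup_{x\in X}|s_\omega'(x)|^t\in\mathbb{R}\cup\{\infty\}$ for $t\ge0$. $\mathcal{S}$ is regular if $P_{\mathcal{S}}(t)=0$ for some $t\ge0$. The systems. $\mathcal{D}$ is the set of real sequences $\{d_n\}_{n\ge1}$ with $d_1\ge2$ and $d_{n+1}-d_n\ge2$ for all $n$. For $\alpha\in\mathbb{C}$, $|\alpha|\ge2$, define $f_\alpha,g_\alpha:\overline{\mathbb{D}}\to\overline{\mathbb{D}}$ by $f_\alpha(z)=\frac{z+\overline{\alpha}}{|\alpha|^2-1}$, $g_\alpha(z)=\frac1{z+\alpha}$. For $\mathbf{d}=\{d_n\}\in\mathcal{D}$, $T\in\mathbb{N}$: $\mathcal{F}(\mathbf{d},T)=\{f_{e(j/T)d_n}:n\in\mathbb{N},\,j=0,\dots,T-1\}$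 and $\mathcal{G}(\mathbf{d},T)=\{g_{e(j/T)d_n}:n\in\mathbb{N},\,j=0,\dots,T-1\}$, families of maps on $X=\overline{\mathbb{D}}$. *)

(* Defs.v *)
(* The reals are an arbitrary [R : realType], and R^d is
   ['rV[R]_d] with its (sup-norm) topology, but with all metric notions below
   taken with respect to the Euclidean norm [enorm]. *)
From HB Require Import structures.
From mathcomp Require Import all_boot all_order all_algebra.
From mathcomp Require Import complex.
From mathcomp Require Import all_classical all_reals all_analysis.
Set Implicit Arguments.
Unset Strict Implicit.
Unset Printing Implicit Defensive.
Import Order.TTheory GRing.Theory Num.Theory.
Import numFieldNormedType.Exports.

Local Open Scope classical_set_scope.
Local Open Scope ring_scope.

Section Euclidean.
Variables (R : realType) (d : nat).
Local Notation E := 'rV[R]_d.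

Definition edot (u v : E) : R := \sum_(i < d) u 0 i * v 0 i.

Definition enorm (u : E) : R := Num.sqrt (edot u u).

Definition opnorm (A : E -> E) : R :=
  sup [set enorm (A v) | v in [set v | enorm v <= 1]].

Definition Lip (X : set E) (f : E -> E) : \bar R :=
  ereal_sup [set (enorm (f p.1 - f p.2) / enorm (p.1 - p.2))%:E |
             p in [set p : E * E | [/\ X p.1, X p.2 & p.1 <> p.2]]].

(* [-oo] when [U] is empty *)
Definition diam (U : set E) : \bar R :=
  ereal_sup [set (enorm (p.1 - p.2))%:E | p in [set p : E * E | U p.1 /\ U p.2]].

(* diam(U)^s, with the conventions that the empty set contributes 0 and
   0^0 = 1 *)
Definition hausdorff_gauge (s : R) (U : set E) : \bar R :=
  if U == set0 then 0%E else poweR (diam U) s.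

Definition hausdorff_content (s delta : R) (A : set E) : \bar R :=
  ereal_inf [set (\sum_(0 <= k <oo) hausdorff_gauge s (U k))%E |
             U in [set U : nat -> set E | A `<=` \bigcup_k U k /\
                                          forall k, (diam (U k) <= delta%:E)%E]].

Definition hausdorff_measure (s : R) (A : set E) : \bar R :=
  ereal_sup [set hausdorff_content s delta A | delta in [set delta | 0 < delta]].

Definition hausdorff_dim (A : set E) : \bar R :=
  ereal_inf [set s%:E | s in [set s | 0 <= s /\ hausdorff_measure s A = 0%E]].

(* [f] is of class C^{1+eps} on the open set [V]: differentiable with
   (locally) eps-Hoelder derivative. *)
Definition C1eps (eps : R) (V : set E) (f : E -> E) : Prop :=
  (forall x, V x -> differentiable f x) /\
  (forall x, V x -> exists (C : R) (U : set E),
     [/\ nbhs x U, U `<=` V &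
      forall y z, U y -> U z ->
        opnorm (fun v => 'd f y v - 'd f z v) <= C * enorm (y - z) `^ eps]).

(* diffeomorphism of [V] onto the open set [f @` V] *)
Definition C1eps_diffeo (eps : R) (V : set E) (f : E -> E) : Prop :=
  [/\ C1eps eps V f, open (f @` V) &
      exists g : E -> E, C1eps eps (f @` V) g /\ forall x, V x -> g (f x) = x].

(* the differential is a similarity *)
Definition conformal_on (V : set E) (f : E -> E) : Prop :=
  forall x, V x -> exists2 r : R, 0 < r & forall v, enorm ('d f x v) = r * enorm v.

End Euclidean.

Section CIFS.
Variables (R : realType) (d : nat) (I : countType).
Local Notation E := 'rV[R]_d.
(* Only the restriction of [s i] to [X] is meaningful. *)
Variables (X : set E) (s : I -> E -> E).

Definition word_map (f : I -> E -> E) (w : seq I) : E -> E :=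
  foldr (fun i g => f i \o g) id w.

Definition limit_set : set E :=
  \bigcup_(w in [set: nat -> I])
    \bigcap_(N in [set N | (0 < N)%N]) (word_map s (mkseq w N) @` X).

Definition is_IFS : Prop :=
  [/\ compact X, connected X, exists i j : I, i <> j,
      forall i, s i @` X `<=` X /\
                (forall x y, X x -> X y -> s i x = s i y -> x = y) &
      (ereal_sup [set Lip X (s i) | i in [set: I]] < 1)%E].

Definition open_set_condition : Prop :=
  forall i j, i <> j -> (s i @` X°) `&` (s j @` X°) = set0.

Definition cone_condition : Prop :=
  exists alpha l : R, [/\ 0 < alpha, alpha < pi / 2, 0 < l &
    forall x, (closure X `\` X°) x -> exists2 u : E, u <> 0 &
      [set y | 0 < enorm (y - x) < l /\
               enorm (y - x) * enorm u * cos alpha < edot (y - x) u]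
      `<=` X°].

(* The maps [e i] extend the [s i] to conformal C^{1+eps} diffeomorphisms of [V]
   into itself, so that the [word_map e w] are defined on [V]. *)
Definition conformal_extension (V : set E) (e : I -> E -> E) : Prop :=
  [/\ [/\ open V, connected V & X `<=` V],
      forall i x, X x -> e i x = s i x,
      forall i, e i @` V `<=` V,
      exists2 eps : R, 0 < eps & forall i, C1eps_diffeo eps V (e i) &
      forall i, conformal_on V (e i)].

Definition bounded_distortion (V : set E) (e : I -> E -> E) : Prop :=
  exists2 K : R, 1 <= K & forall (w : seq I) x y, (0 < size w)%N -> V x -> V y ->
    opnorm ('d (word_map e w) y) <= K * opnorm ('d (word_map e w) x).

Definition is_CIFS : Prop :=
  [/\ is_IFS, open_set_condition, cone_condition &
      exists V e, conformal_extension V e /\ bounded_distortion V e].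

Definition partition_function (e : I -> E -> E) (N : nat) (t : R) : \bar R :=
  \esum_(w in [set: N.-tuple I])
    ereal_sup [set (opnorm ('d (word_map e w) x) `^ t)%:E | x in X].

(* P(t) = p, for the pressure P computed with the extensions [e] *)
Definition pressure_is (e : I -> E -> E) (t : R) (p : \bar R) : Prop :=
  (fun N : nat => (N%:R^-1)%:E * lne (partition_function e N t))%E @ \oo --> p.

(* By the cone condition every point of [X] is a limit of interior points, so
   the derivatives on [X], hence the pressure, do not depend on the choice of
   [V] and [e]. *)
Definition is_regular : Prop :=
  exists V e, [/\ conformal_extension V e, bounded_distortion V e &
                  exists2 t : R, 0 <= t & pressure_is e t 0%E].

End CIFS.

Section Systems.
Variable R : realType.
Local Notation C := R[i].

Definition toC (v : 'rV[R]_2) : C := Complex (v 0 0) (v 0 1).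
Definition ofC (z : C) : 'rV[R]_2 :=
  \row_(j < 2) if j == 0 then complex.Re z else complex.Im z.

Definition closed_disk : set 'rV[R]_2 := [set v | `|toC v| <= 1].

Definition cexp (theta : R) : C :=
  Complex (cos (2 * pi * theta)) (sin (2 * pi * theta)).

(* Sequences are indexed from 0: [d n] stands for d_{n+1}. *)
Definition spaced_seq (d : nat -> R) : Prop :=
  2 <= d 0%N /\ forall n, 2 <= d n.+1 - d n.

Definition f_map (alpha z : C) : C := (z + Num.conj alpha) / (`|alpha| ^+ 2 - 1).
Definition g_map (alpha z : C) : C := (z + alpha)^-1.

Definition alpha_of (d : nat -> R) (T : nat) (p : nat * 'I_T) : C :=
  cexp (p.2%:R / T%:R) * (d p.1)%:C%C.

Definition F_family (d : nat -> R) (T : nat) (p : nat * 'I_T) :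
  'rV[R]_2 -> 'rV[R]_2 := ofC \o f_map (alpha_of d p) \o toC.
Definition G_family (d : nat -> R) (T : nat) (p : nat * 'I_T) :
  'rV[R]_2 -> 'rV[R]_2 := ofC \o g_map (alpha_of d p) \o toC.

End Systems.

(* Main.v *)
(* Write r_n = 1/(d_n^2 - 1), the ratio of the four similitudes of F attached to d_n,
   and h for the dimension of J_G. For |z| <= 1 and 0 < t < 1,
     sum_(j < 4) |z + i^j d|^(-2t) < 4 (d^2 - 1)^(-t)
   as soon as d >= 2 (if t <= 1/2) or d >= 4/(1 - t) (if t > 1/2): the case t = 1/2
   follows from a rational upper bound of the square root, smaller t from concavity,
   larger t by interpolating between the exponents 1/2 and 1, where the sum exceeds
   its bound only by 8/(d^4 - 1).
   If sum_n 4 r_n^h <= 1, then the sums sum_g |g'(z)|^h over G are at most some q < 1,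
   so that the level-N sums at exponent h decay like q^N. This forces the zero t0 of
   the pressure to be smaller than h, while covering J_G by the level-N images of the
   disk shows that its dimension is at most t0; a contradiction.
   Hence finitely many of the 4 r_n^h already sum to more than 1, and by continuity
   sum_(n < M) 4 r_n^s >= 1 for some s > h. The corresponding finite subsystem of F is
   made of similitudes satisfying the open set condition, so its limit set has
   dimension at least s. *)
Require Import Defs.
From HB Require Import structures.
From mathcomp Require Import all_boot all_order all_algebra.
From mathcomp Require Import complex ring lra.
From mathcomp Require Import all_classical all_reals all_analysis.
Set Implicit Arguments.
Unset Strict Implicit.
Unset Printing Implicit Defensive.
Import Order.TTheory GRing.Theory Num.Theory.
Import numFieldNormedType.Exports.
Local Open Scope classical_set_scope.
Local Open Scope ring_scope.

(** * The pointwise inequality *)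

Section PointwiseInequality.
Variable R : realType.
Implicit Types (x y d t v E : R).

(** Convexity of the inverse: [K] and [K - p - q] have the same sum as [K - p] and [K - q] but lie
    further apart. *)
Lemma pair_inv_le (K p q : R) : 0 <= p -> 0 <= q -> p + q < K ->
  (K - p)^-1 + (K - q)^-1 <= K^-1 + (K - p - q)^-1.
Proof.
move=> p0 q0 pq.
have K0 : 0 < K by lra.
have Kp : 0 < K - p by lra.
have Kq : 0 < K - q by lra.
have Kpq : 0 < K - p - q by lra.
rewrite -subr_ge0.
have -> : K^-1 + (K - p - q)^-1 - ((K - p)^-1 + (K - q)^-1) =
  (2 * K - p - q) * (p * q) / (K * (K - p - q) * (K - p) * (K - q)).
  by field; rewrite !gt_eqF.
rewrite divr_ge0 ?mulr_ge0//; lra.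
Qed.

(** With [E] = d^2, [a] = x^2, [b] = y^2, each fraction is the sum of (d^2 - 1) / |z + i^j d|^2 over
    two opposite j. By [pair_inv_le] the worst case puts all of [a + b] on one axis, and the bound
    is the value there at [a + b] = 1. *)
Lemma sum4_sq_le (E a b A : R) : 2 <= E -> 0 <= a -> 0 <= b -> a + b <= 1 ->
  A = E + a + b ->
  2 * A * (E - 1) / (A ^+ 2 - 4 * E * a) + 2 * A * (E - 1) / (A ^+ 2 - 4 * E * b)
    <= 4 + 8 / (E ^+ 2 - 1).
Proof.
move=> E2 a0 b0 ab AE.
set s := a + b in ab *.
have As : A = E + s by rewrite AE /s; lra.
have s0 : 0 <= s by rewrite /s; lra.
have A0 : 0 < A by lra.
have Es : 0 < E - s by lra.
have key : (A ^+ 2 - 4 * E * a)^-1 + (A ^+ 2 - 4 * E * b)^-1 <=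
    (A ^+ 2)^-1 + (A ^+ 2 - 4 * E * a - 4 * E * b)^-1.
  apply: pair_inv_le; try by rewrite !mulr_ge0//; lra.
  have -> : 4 * E * a + 4 * E * b = 4 * E * s by rewrite /s; ring.
  by rewrite As; nra.
rewrite -mulrDr.
apply: (@le_trans _ _ (2 * A * (E - 1) * ((A ^+ 2)^-1 + ((E - s) ^+ 2)^-1))).
  rewrite ler_pM2l; last by rewrite !mulr_gt0//; lra.
  apply: (le_trans key); rewrite lerD2l.
  have -> // : A ^+ 2 - 4 * E * a - 4 * E * b = (E - s) ^+ 2.
  by rewrite As /s; ring.
have -> : 2 * A * (E - 1) * ((A ^+ 2)^-1 + ((E - s) ^+ 2)^-1) =
    4 * ((E - 1) / (E - s)) * ((E ^+ 2 + s ^+ 2) / (E ^+ 2 - s ^+ 2)).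
  rewrite As; field.
  have -> : E ^+ 2 - s ^+ 2 = (E + s) * (E - s) by ring.
  by rewrite mulf_neq0 !gt_eqF//; lra.
have E1 : 0 < E ^+ 2 - 1 by nra.
have Es2 : 0 < E ^+ 2 - s ^+ 2 by nra.
have -> : 4 + 8 / (E ^+ 2 - 1) = 4 * 1 * ((E ^+ 2 + 1) / (E ^+ 2 - 1)).
  by field; rewrite gt_eqF.
apply: ler_pM.
- by rewrite mulr_ge0// divr_ge0//; lra.
- by rewrite divr_ge0//; nra.
- rewrite ler_wpM2l// ler_pdivrMr//; lra.
- rewrite ler_pdivrMr// mulrAC ler_pdivlMr// -subr_ge0.
  have -> : (E ^+ 2 + 1) * (E ^+ 2 - s ^+ 2) - (E ^+ 2 + s ^+ 2) * (E ^+ 2 - 1) =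
    2 * E ^+ 2 * ((1 - s) * (1 + s)) by ring.
  by rewrite !mulr_ge0//; lra.
Qed.

(** The same argument for the shifted denominators |z + i^j d|^2 + d^2 - 1; the bound is again the
    value for [a + b] = 1 on one axis. *)
Lemma sum4_shift_le (E a b B : R) : 2 <= E -> 0 <= a -> 0 <= b -> a + b <= 1 ->
  B = 2 * E - 1 + a + b ->
  2 * B * (E - 1) / (B ^+ 2 - 4 * E * a) + 2 * B * (E - 1) / (B ^+ 2 - 4 * E * b)
    <= 2 - E^-1.
Proof.
move=> E2 a0 b0 ab BE.
set s := a + b in ab *.
have Bs : B = 2 * E - 1 + s by rewrite BE /s; lra.
have s0 : 0 <= s by rewrite /s; lra.
have B0 : 0 < B by lra.
set c := 2 * E - 1.
have c3 : 3 <= c by rewrite /c; lra.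
have Ec : E = (c + 1) / 2 by rewrite /c; field.
have Bc : B = c + s by rewrite Bs.
have Q0 : 0 < c ^+ 2 - 2 * s + s ^+ 2 by nra.
have QE : B ^+ 2 - 4 * E * a - 4 * E * b = c ^+ 2 - 2 * s + s ^+ 2.
  by rewrite Bc Ec /s; field.
have key : (B ^+ 2 - 4 * E * a)^-1 + (B ^+ 2 - 4 * E * b)^-1 <=
    (B ^+ 2)^-1 + (B ^+ 2 - 4 * E * a - 4 * E * b)^-1.
  apply: pair_inv_le; try by rewrite !mulr_ge0//; lra.
  by rewrite -subr_gt0 opprD addrA QE.
rewrite -mulrDr.
apply: (@le_trans _ _ (2 * B * (E - 1) * ((B ^+ 2)^-1 + (c ^+ 2 - 2 * s + s ^+ 2)^-1))).
  rewrite ler_pM2l; last by rewrite !mulr_gt0//; lra.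
  by apply: (le_trans key); rewrite lerD2l QE.
have cs0 : 0 < c + s by lra.
have c10 : 0 < c + 1 by lra.
rewrite Bc Ec -subr_ge0.
have -> : 2 - ((c + 1) / 2)^-1 - 2 * (c + s) * ((c + 1) / 2 - 1) *
    (((c + s) ^+ 2)^-1 + (c ^+ 2 - 2 * s + s ^+ 2)^-1) =
  2 * ((1 - s) * (c ^+ 2 + c * s * (1 - s) - s)) /
    ((c + 1) * (c + s) * (c ^+ 2 - 2 * s + s ^+ 2)).
  by field; rewrite !gt_eqF.
rewrite divr_ge0 ?mulr_ge0//; try lra; try nra.
have h1 : 0 <= c * s * (1 - s) by rewrite !mulr_ge0//; lra.
by nra.
Qed.

(* One Newton step for the square root, started at [(1 + v) / 2]. *)
Lemma sqrt_le_newton v : 0 <= v -> Num.sqrt v <= (1 + v + 4 * v / (1 + v)) / 4.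
Proof.
move=> v0; set w := Num.sqrt v.
have w0 : 0 <= w by exact: sqrtr_ge0.
have -> : v = w ^+ 2 by rewrite sqr_sqrtr.
have h : 0 < 1 + w ^+ 2 by nra.
rewrite -subr_ge0.
have -> : (1 + w ^+ 2 + 4 * w ^+ 2 / (1 + w ^+ 2)) / 4 - w =
   (w - 1) ^+ 4 / (4 * (1 + w ^+ 2)) by field; rewrite gt_eqF.
by rewrite divr_ge0// ?exprn_even_ge0// mulr_ge0// ltW.
Qed.

(** Young's inequality for v^t and 1 with the conjugate exponents 1/t and 1/(1 - t). *)
Lemma powR_le_tangent v t : 0 <= v -> 0 <= t <= 1 -> v `^ t <= 1 + t * (v - 1).
Proof.
move=> v0 /andP[t0 t1].
have [->|tn0] := eqVneq t 0; first by rewrite powRr0 mul0r addr0.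
have [->|tn1] := eqVneq t 1; first by rewrite powRr1// mul1r addrC subrK.
have tp : 0 < t by rewrite lt_neqAle eq_sym tn0.
have tl : 0 < 1 - t by rewrite subr_gt0 lt_neqAle tn1.
have := @conjugate_powR R (v `^ t) 1 t^-1 (1 - t)^-1 (powR_ge0 _ _) ler01.
rewrite !invr_gt0 !invrK mulr1 powR1 mul1r -powRrM mulfV// powRr1// => /(_ tp tl).
rewrite subrKC => /(_ erefl) h; apply: (le_trans h); lra.
Qed.

(** The exponent t is the convex combination (2t - 1) * 1 + 2(1 - t) * (1/2); the tangent bound is
    applied to the factor sqrt(v)^(2t - 1). *)
Lemma powR_le_chord v t : 0 <= v -> 1 / 2 <= t <= 1 ->
  v `^ t <= (2 * t - 1) * v + 2 * (1 - t) * Num.sqrt v.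
Proof.
move=> v0 /andP[t0 t1].
have -> : v `^ t = Num.sqrt v * Num.sqrt v `^ (2 * t - 1).
  rewrite -powR12_sqrt// -powRrM -powRD; last by apply/implyP => /eqP; lra.
  by congr (_ `^ _); field.
apply: (@le_trans _ _ (Num.sqrt v * (1 + (2 * t - 1) * (Num.sqrt v - 1)))).
  rewrite ler_wpM2l ?sqrtr_ge0// powR_le_tangent ?sqrtr_ge0//; lra.
rewrite le_eqVlt; apply/orP; left; apply/eqP.
rewrite -[in X in _ = X + _](sqr_sqrtr v0); ring.
Qed.

(** The squared modulus |z + i^j d|^2 at z = x + iy. *)
Definition distsq (d x y : R) (j : nat) : R :=
  match j with
  | 0 => (x + d) ^+ 2 + y ^+ 2
  | 1 => x ^+ 2 + (y + d) ^+ 2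
  | 2 => (x - d) ^+ 2 + y ^+ 2
  | _ => x ^+ 2 + (y - d) ^+ 2
  end.

Lemma distsq_ge d x y j : 1 <= d -> x ^+ 2 + y ^+ 2 <= 1 ->
  (d - 1) ^+ 2 <= distsq d x y j.
Proof.
move=> d1 xy.
have xs : x ^+ 2 <= 1 by nra.
have ys : y ^+ 2 <= 1 by nra.
have x1 : -1 <= x <= 1.
  by rewrite -ler_norml -(@expr_le1 _ 2)// -normrX ger0_norm ?sqr_ge0.
have y1 : -1 <= y <= 1.
  by rewrite -ler_norml -(@expr_le1 _ 2)// -normrX ger0_norm ?sqr_ge0.
move: j => [|[|[|j]]] /=; nra.
Qed.

(** * Sums over the four rotations of one [d] *)

Section FourTerms.
Variables (d x y : R).
Hypotheses (d2 : 2 <= d) (xy1 : x ^+ 2 + y ^+ 2 <= 1).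
Let D := d ^+ 2 - 1.

Let d4 : 4 <= d ^+ 2.
Proof. by have := ler_pM (ler0n R 2) (ler0n R 2) d2 d2; rewrite -expr2; lra. Qed.

Let D0 : 0 < D. Proof. by rewrite /D; have := d4; lra. Qed.

Let w0 j : 0 < distsq d x y j.
Proof.
have hd := d2.
have d1 : 1 <= d by lra.
by apply: lt_le_trans (@distsq_ge d x y j d1 xy1); rewrite exprn_gt0//; lra.
Qed.

Let four (f : R -> R) := \sum_(j < 4) f (D / distsq d x y j).

Let fourE f : four f = (f (D / distsq d x y 0) + f (D / distsq d x y 2)) +
  (f (D / distsq d x y 1) + f (D / distsq d x y 3)).
Proof. rewrite /four !big_ord_recr big_ord0 /= add0r; ring. Qed.

Lemma four_id_le : \sum_(j < 4) D / distsq d x y j <= 4 + 8 / (d ^+ 4 - 1).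
Proof.
have hd := d2.
have E2 : 2 <= d ^+ 2 by have := d4; lra.
have -> : d ^+ 4 = (d ^+ 2) ^+ 2 by ring.
apply: le_trans (@sum4_sq_le (d ^+ 2) _ _ _ E2 (sqr_ge0 x) (sqr_ge0 y) xy1 erefl).
rewrite [X in X <= _](fourE id) /= le_eqVlt; apply/orP; left; apply/eqP.
have := w0 0; have := w0 1; have := w0 2; have := w0 3; rewrite /= => h3 h2 h1 h0.
(* The denominators of [sum4_sq_le] are products of squared distances to opposite centres. *)
have -> : (d ^+ 2 + x ^+ 2 + y ^+ 2) ^+ 2 - 4 * d ^+ 2 * x ^+ 2 =
  ((x + d) ^+ 2 + y ^+ 2) * ((x - d) ^+ 2 + y ^+ 2) by ring.
have -> : (d ^+ 2 + x ^+ 2 + y ^+ 2) ^+ 2 - 4 * d ^+ 2 * y ^+ 2 =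
  (x ^+ 2 + (y + d) ^+ 2) * (x ^+ 2 + (y - d) ^+ 2) by ring.
by rewrite /D; field; rewrite !gt_eqF.
Qed.

(** The Newton bound is 1/4 + v/4 + v/(1 + v); for v = D/w the last term is D/(w + D), so the two
    preceding four-term bounds apply. *)
Lemma four_sqrt_le :
  \sum_(j < 4) Num.sqrt (D / distsq d x y j) <= 4 - 7 / 15 / d ^+ 2.
Proof.
have hd := d2.
have E4 := d4.
have E2 : 2 <= d ^+ 2 by lra.
have step j : Num.sqrt (D / distsq d x y j) <=
    4^-1 + 4^-1 * (D / distsq d x y j) + D / (distsq d x y j + D).
  apply: (le_trans (sqrt_le_newton _)); first by rewrite divr_ge0 ?ltW.
  rewrite le_eqVlt; apply/orP; left; apply/eqP.
  have := w0 j => wj; field.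
  by have wD := addr_gt0 wj D0; rewrite !gt_eqF.
apply: (le_trans (ler_sum _ (fun (j : 'I_4) _ => step j))).
rewrite !big_split /= -mulr_sumr sumr_const card_ord.
have h1 := four_id_le.
have h2 : \sum_(j < 4) D / (distsq d x y j + D) <= 2 - (d ^+ 2)^-1.
  apply: le_trans (@sum4_shift_le (d ^+ 2) _ _ _ E2 (sqr_ge0 x) (sqr_ge0 y) xy1 erefl).
  rewrite le_eqVlt; apply/orP; left; apply/eqP.
  have := w0 0; have := w0 1; have := w0 2; have := w0 3; rewrite /= => q3 q2 q1 q0.
  have -> : (2 * d ^+ 2 - 1 + x ^+ 2 + y ^+ 2) ^+ 2 - 4 * d ^+ 2 * x ^+ 2 =
    ((x + d) ^+ 2 + y ^+ 2 + D) * ((x - d) ^+ 2 + y ^+ 2 + D) by rewrite /D; ring.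
  have -> : (2 * d ^+ 2 - 1 + x ^+ 2 + y ^+ 2) ^+ 2 - 4 * d ^+ 2 * y ^+ 2 =
    (x ^+ 2 + (y + d) ^+ 2 + D) * (x ^+ 2 + (y - d) ^+ 2 + D) by rewrite /D; ring.
  rewrite !big_ord_recr big_ord0 /= add0r.
  have := addr_gt0 q0 D0; have := addr_gt0 q1 D0.
  have := addr_gt0 q2 D0; have := addr_gt0 q3 D0; rewrite /D => p3 p2 p1 p0.
  by field; rewrite !gt_eqF.
(* Equality at d^2 = 4, the smallest value allowed; of the gain 1/d^2 there remains 7/15. *)
have h3 : 2 / (d ^+ 4 - 1) <= 8 / 15 / d ^+ 2.
  have -> : d ^+ 4 = (d ^+ 2) ^+ 2 by ring.
  rewrite ler_pdivrMr; last by nra.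
  rewrite mulrAC ler_pdivlMr; nra.
have h4 : 8 / (d ^+ 4 - 1) = 4 * (2 / (d ^+ 4 - 1)) by ring.
have h5 : (d ^+ 2)^-1 = 8 / 15 / d ^+ 2 + 7 / 15 / d ^+ 2.
  by rewrite -mulrDl -mulrDl; field; rewrite gt_eqF//; lra.
rewrite -[_ *+ 4]mulr_natr; lra.
Qed.

(** The function L of the theorem; it exceeds 8 for 1/2 < t < 1. *)
Definition threshold t : R := if t <= 1 / 2 then 2 else 4 / (1 - t).

(** A lower bound for how far the four-term sum stays below 4. For t > 1/2 the factor 2/3 is 14/15 -
    4/15: the gain at exponent 1/2 minus the excess at exponent 1. *)
Definition gap t : R :=
  if t <= 1 / 2 then 2 * t * (7 / 15 / d ^+ 2)
  else 2 / 3 * (1 - t) / d ^+ 2.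

Lemma four_powR_le t : 0 < t -> t < 1 -> threshold t <= d ->
  \sum_(j < 4) (D / distsq d x y j) `^ t <= 4 - gap t.
Proof.
have hd := d2.
move=> t0 t1; rewrite /threshold /gap.
have v0 j : 0 <= D / distsq d x y j by rewrite divr_ge0 ?ltW.
case: ifPn => [th _|].
  have step j : (D / distsq d x y j) `^ t <=
      1 - 2 * t + 2 * t * Num.sqrt (D / distsq d x y j).
    have -> : (D / distsq d x y j) `^ t = Num.sqrt (D / distsq d x y j) `^ (2 * t).
      by rewrite -powR12_sqrt// -powRrM; congr (_ `^ _); field.
    apply: (le_trans (powR_le_tangent _ _)); [exact: sqrtr_ge0| lra |lra].
  apply: (le_trans (ler_sum _ (fun (j : 'I_4) _ => step j))).
  rewrite big_split /= -mulr_sumr sumr_const card_ord.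
  have := four_sqrt_le; rewrite -[_ *+ 4]mulr_natr.
  set s := \sum_(j < 4) _; set q := 7 / 15 / _ => h.
  have : 2 * t * s <= 2 * t * (4 - q) by rewrite ler_wpM2l//; lra.
  lra.
rewrite -ltNge => th.
have t1' : 0 < 1 - t by lra.
rewrite ler_pdivrMr// => dL.
have step j : (D / distsq d x y j) `^ t <=
    (2 * t - 1) * (D / distsq d x y j) + 2 * (1 - t) * Num.sqrt (D / distsq d x y j).
  by apply: powR_le_chord => //; lra.
apply: (le_trans (ler_sum _ (fun (j : 'I_4) _ => step j))).
rewrite big_split /= -mulr_sumr -[X in _ + X <= _]mulr_sumr.
have h1 := four_id_le; have h2 := four_sqrt_le; have E4 := d4.
set s := \sum_(j < 4) _ in h1 *; set s' := \sum_(j < 4) _ in h2 *.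
(* Here d > 8 and d (1 - t) >= 4, which makes 8/(d^4 - 1) small against (1 - t)/d^2. *)
have E16 : 32 <= d ^+ 2 * (1 - t).
  have : 8 * 4 <= d * (d * (1 - t)) by apply: ler_pM; nra.
  by rewrite mulrA -expr2; lra.
have E1 : 32 <= d ^+ 2 by nra.
have h3 : 8 / (d ^+ 4 - 1) <= 4 / 15 * (1 - t) / d ^+ 2.
  have -> : d ^+ 4 = (d ^+ 2) ^+ 2 by ring.
  rewrite ler_pdivrMr; last by nra.
  rewrite mulrAC ler_pdivlMr; nra.
have a1 : (2 * t - 1) * s <= (2 * t - 1) * (4 + 8 / (d ^+ 4 - 1)).
  by rewrite ler_wpM2l//; lra.
have a2 : 2 * (1 - t) * s' <= 2 * (1 - t) * (4 - 7 / 15 / d ^+ 2).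
  by rewrite ler_wpM2l//; lra.
have a3 : (2 * t - 1) * (8 / (d ^+ 4 - 1)) <= 1 * (4 / 15 * (1 - t) / d ^+ 2).
  apply: ler_pM => //; [lra| |lra].
  rewrite divr_ge0//.
  have -> : d ^+ 4 = (d ^+ 2) ^+ 2 by ring.
  by nra.
apply: (le_trans (lerD a1 a2)).
apply: (@le_trans _ _ (4 + 1 * (4 / 15 * (1 - t) / d ^+ 2) - 2 * (1 - t) * (7 / 15 / d ^+ 2))).
  move: a3; set u := 8 / _; set w := 7 / 15 / _; set z := 1 * _; lra.
rewrite le_eqVlt; apply/orP; left; apply/eqP; field; rewrite gt_eqF; lra.
Qed.

Lemma gap_gt0 t : 0 < t -> t < 1 -> 0 < gap t.
Proof.
have hd := d2.
move=> t0 t1; have E : 0 < d ^+ 2 by have := d4; lra.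
have t1' : 0 < 1 - t by lra.
have Ei : 0 < (d ^+ 2)^-1 by rewrite invr_gt0.
by rewrite /gap; case: ifPn => _; rewrite !mulr_gt0// ?invr_gt0.
Qed.

(* [(distsq d x y j)^-1] is the modulus of the derivative of [z -> 1 / (z + i^j d)]. *)
Lemma four_derivatives_le t : 0 < t -> t < 1 -> threshold t <= d ->
  \sum_(j < 4) (distsq d x y j)^-1 `^ t <= (4 - gap t) * D^-1 `^ t.
Proof.
have hd := d2.
move=> t0 t1 dt.
have Di : 0 <= D^-1 by rewrite invr_ge0 ltW.
have -> : \sum_(j < 4) (distsq d x y j)^-1 `^ t =
    (\sum_(j < 4) (D / distsq d x y j) `^ t) * D^-1 `^ t.
  rewrite mulr_suml; apply: eq_bigr => j _.
  rewrite -powRM ?(divr_ge0 (ltW D0) (ltW (w0 _)))//.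
  by rewrite mulrAC divff ?mul1r// gt_eqF.
by rewrite ler_wpM2r ?powR_ge0// four_powR_le.
Qed.

End FourTerms.

End PointwiseInequality.

(** * Plane geometry of the two systems *)

Section Plane.
Variable R : realType.
Local Notation E := 'rV[R]_2.
Implicit Types (u v w : E) (a : R).

Lemma row2P u v : u 0 0 = v 0 0 -> u 0 1 = v 0 1 -> u = v.
Proof.
move=> h0 h1; apply/rowP => i; case: (unliftP 0 i) => [j ->|-> //].
by rewrite (ord1 j) (_ : lift 0 0 = 1)//; apply/val_inj.
Qed.

Lemma enorm2E v : enorm v = Num.sqrt (v 0 0 ^+ 2 + v 0 1 ^+ 2).
Proof.
rewrite /enorm /edot !big_ord_recl big_ord0 addr0 !expr2.
by rewrite (_ : lift 0 0 = 1)//; apply/val_inj.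
Qed.

Lemma enorm_ge0 v : 0 <= enorm v.
Proof. exact: sqrtr_ge0. Qed.

Lemma sqr_enorm v : enorm v ^+ 2 = v 0 0 ^+ 2 + v 0 1 ^+ 2.
Proof. by rewrite enorm2E sqr_sqrtr// addr_ge0 ?sqr_ge0. Qed.

Lemma enorm0 : enorm (0 : E) = 0.
Proof. by rewrite enorm2E !mxE expr0n addr0 sqrtr0. Qed.

Lemma enormZ a v : enorm (a *: v) = `|a| * enorm v.
Proof.
rewrite !enorm2E -sqrtr_sqr -sqrtrM ?sqr_ge0//; congr Num.sqrt.
by rewrite !mxE; ring.
Qed.

Lemma enormN v : enorm (- v) = enorm v.
Proof. by rewrite -scaleN1r enormZ normrN1 mul1r. Qed.

Lemma enorm_distC u v : enorm (u - v) = enorm (v - u).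
Proof. by rewrite -enormN opprB. Qed.

Lemma enorm_eq0 v : (enorm v == 0) = (v == 0).
Proof.
apply/idP/idP => [/eqP e|/eqP ->]; last by rewrite enorm0.
have := sqr_enorm v; rewrite e expr0n => /esym/eqP.
rewrite paddr_eq0 ?sqr_ge0// !sqrf_eq0 => /andP[/eqP h0 /eqP h1].
by apply/eqP/row2P; rewrite mxE.
Qed.

Lemma enorm_le_sqr v a : 0 <= a -> (enorm v <= a) = (v 0 0 ^+ 2 + v 0 1 ^+ 2 <= a ^+ 2).
Proof. by move=> a0; rewrite -sqr_enorm ler_pXn2r// nnegrE enorm_ge0. Qed.

Lemma enorm_triangle u v : enorm (u + v) <= enorm u + enorm v.
Proof.
rewrite enorm_le_sqr ?addr_ge0 ?enorm_ge0// sqrrD !sqr_enorm !mxE.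
(* Cauchy-Schwarz, by Lagrange's identity. *)
have cs : u 0 0 * v 0 0 + u 0 1 * v 0 1 <= enorm u * enorm v.
  apply: (le_trans (ler_norm _)).
  rewrite -(@ler_pXn2r _ 2)// ?nnegrE ?mulr_ge0 ?enorm_ge0//.
  rewrite -normrX ger0_norm ?sqr_ge0// exprMn !sqr_enorm -subr_ge0.
  rewrite (_ : _ - _ = (u 0 0 * v 0 1 - u 0 1 * v 0 0) ^+ 2) ?sqr_ge0//; ring.
rewrite -[_ *+ 2]mulr_natr; move: cs; set s := enorm u * enorm v; nra.
Qed.

Lemma coord_le_enorm v i : `|v 0 i| <= enorm v.
Proof.
rewrite -(@ler_pXn2r _ 2)// ?nnegrE ?enorm_ge0// -normrX ger0_norm ?sqr_ge0//.
rewrite sqr_enorm; case: (unliftP 0 i) => [j ->|->]; last by rewrite lerDl sqr_ge0.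
by rewrite (ord1 j) (_ : lift 0 0 = 1) ?lerDr ?sqr_ge0//; apply/val_inj.
Qed.

Lemma enorm_lt v a : 0 < a -> `|v 0 0| < a / 2 -> `|v 0 1| < a / 2 -> enorm v < a.
Proof.
move=> a0 h0 h1; apply: (@le_lt_trans _ _ (`|v 0 0| + `|v 0 1|)); last by lra.
rewrite enorm_le_sqr ?addr_ge0// sqrrD !real_normK ?num_real//.
by rewrite addrAC lerDl mulrn_wge0// mulr_ge0.
Qed.

Lemma closed_diskE v : closed_disk v <-> v 0 0 ^+ 2 + v 0 1 ^+ 2 <= 1.
Proof.
rewrite /closed_disk /= normc_def /toC /= -[X in _ <= X]/((1 : R)%:C%C) lecR.
by rewrite -enorm2E enorm_le_sqr// expr1n; split.
Qed.

Lemma closed_diskP v : closed_disk v <-> enorm v <= 1.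
Proof. by rewrite closed_diskE enorm_le_sqr// expr1n; split. Qed.

Lemma closed_disk0 : closed_disk (0 : E).
Proof. by rewrite closed_diskP enorm0. Qed.

Lemma closed_disk_dist u v : closed_disk u -> closed_disk v -> enorm (u - v) <= 2.
Proof.
rewrite !closed_diskP => hu hv; apply: (le_trans (enorm_triangle _ _)).
rewrite enormN; lra.
Qed.

Lemma enorm_continuous : continuous (@enorm R 2).
Proof.
move=> v; rewrite (_ : @enorm R 2 = fun v => Num.sqrt (v 0 0 ^+ 2 + v 0 1 ^+ 2)); last first.
  by apply/funext => w; rewrite enorm2E.
apply: (@continuous_comp _ _ _ (fun v : E => v 0 0 ^+ 2 + v 0 1 ^+ 2) Num.sqrt); last first.
  exact: sqrt_continuous.
have c i : {for v, continuous (fun w : E => w 0 i ^+ 2)}.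
  apply: (@continuous_comp _ _ _ (fun w : E => w 0 i) (fun x : R => x ^+ 2)).
    exact: coord_continuous.
  exact: exprn_continuous.
exact: (cvgD (c 0) (c 1)).
Qed.

(** Makes the open set condition, stated with the topological interior, available at points of
    Euclidean norm below 1. *)
Lemma open_disk_interior v : enorm v < 1 -> (@closed_disk R)° v.
Proof.
move=> v1; rewrite /interior /=.
have : \forall w \near v, enorm w < 1.
  have /cvgrPdist_lt := @enorm_continuous v.
  have e0 : 0 < 1 - enorm v by rewrite subr_gt0.
  move=> /(_ _ e0); apply: filterS => w; rewrite ltr_distlC.
  move=> /andP[_]; lra.
by apply: filterS => w /ltW; rewrite closed_diskP.
Qed.

End Plane.

(** * Real formulas for the maps of both systems *)

Section Maps.
Variables (R : realType) (d : nat -> R).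
Hypothesis d_spaced : spaced_seq d.
Local Notation E := 'rV[R]_2.
Local Notation I := (nat * 'I_4)%type.
Implicit Types (p : I) (u v : E).

Lemma spaced_seq_ge n : d 0%N <= d n.
Proof.
elim: n => // n h; apply: (le_trans h).
by have := d_spaced.2 n; rewrite -subr_ge0 => ?; lra.
Qed.

Lemma spaced_seq_ge2 n : 2 <= d n.
Proof. by apply: le_trans (spaced_seq_ge n); exact: d_spaced.1. Qed.

Lemma cexp_quarter (j : 'I_4) : cexp (j%:R / 4%:R : R) =
  match nat_of_ord j with
  | 0 => Complex 1 0 | 1 => Complex 0 1 | 2 => Complex (-1) 0 | _ => Complex 0 (-1)
  end.
Proof.
rewrite /cexp.
have -> : 2 * pi * (j%:R / 4%:R) = j%:R * (pi / 2) :> R by field.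
case: j => [[|[|[|[|//]]]] ij] /=.
- by rewrite mul0r cos0 sin0.
- by rewrite mul1r cos_pihalf sin_pihalf.
- have -> : 2%:R * (pi / 2) = pi :> R by field.
  by rewrite cospi sinpi.
- have -> : 3%:R * (pi / 2) = pi / 2 + pi :> R by field.
  by rewrite cosDpi sinDpi cos_pihalf sin_pihalf oppr0.
Qed.

Lemma alpha_ofE p : alpha_of d p =
  match nat_of_ord p.2 with
  | 0 => Complex (d p.1) 0 | 1 => Complex 0 (d p.1)
  | 2 => Complex (- d p.1) 0 | _ => Complex 0 (- d p.1)
  end.
Proof.
rewrite /alpha_of cexp_quarter.
by case: p => n [[|[|[|[|//]]]] ij] /=; apply/eqP; rewrite eq_complex /=;
  apply/andP; split; apply/eqP; ring.
Qed.

Lemma sqr_alpha_of p :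
  complex.Re (alpha_of d p) ^+ 2 + complex.Im (alpha_of d p) ^+ 2 = d p.1 ^+ 2.
Proof. by rewrite alpha_ofE; case: (nat_of_ord p.2) => [|[|[|?]]] /=; ring. Qed.

Definition ratio (n : nat) : R := (d n ^+ 2 - 1)^-1.

Lemma F_familyE p v : F_family d p v = ratio p.1 *: (v + ofC (Num.conj (alpha_of d p))).
Proof.
rewrite /F_family /f_map /= -add_Re2_Im2 sqr_alpha_of.
rewrite (_ : (d p.1 ^+ 2)%:C%C - 1 = (d p.1 ^+ 2 - 1)%:C%C); last by rewrite rmorphB rmorph1.
rewrite -fmorphV -/(ratio p.1) mulrC.
case: (alpha_of d p) => a b; apply: row2P; rewrite /ofC /toC !mxE /=; ring.
Qed.

(** This is |z + alpha|^2, the inverse of the modulus of the derivative of 1/(z + alpha). *)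
Definition cnormsq p v : R :=
  (v 0 0 + complex.Re (alpha_of d p)) ^+ 2 + (v 0 1 + complex.Im (alpha_of d p)) ^+ 2.

Lemma cnormsq_distsq p v : cnormsq p v = distsq (d p.1) (v 0 0) (v 0 1)
  (match nat_of_ord p.2 with 0 => 0 | 1 => 1 | 2 => 2 | _ => 3 end).
Proof.
by rewrite /cnormsq alpha_ofE; case: (nat_of_ord p.2) => [|[|[|?]]] /=; ring.
Qed.

Lemma G_familyE p v : G_family d p v = (cnormsq p v)^-1 *:
  \row_(j < 2) (if j == 0 then v 0 0 + complex.Re (alpha_of d p)
                else - (v 0 1 + complex.Im (alpha_of d p))).
Proof.
rewrite /G_family /g_map /cnormsq; case: (alpha_of d p) => a b.
by apply: row2P; rewrite /ofC /toC !mxE /=; ring.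
Qed.

(** The identity |1/a - 1/b| = |a - b| / (|a| |b|): distances are scaled exactly by the geometric
    mean of the derivatives at the two points. *)
Lemma G_family_dist p u v : 0 < cnormsq p u -> 0 < cnormsq p v ->
  enorm (G_family d p u - G_family d p v) =
  Num.sqrt ((cnormsq p u)^-1 * (cnormsq p v)^-1) * enorm (u - v).
Proof.
move=> u0 v0.
rewrite !G_familyE !enorm2E -sqrtrM ?mulr_ge0 ?invr_ge0 ?ltW//; congr Num.sqrt.
move: u0 v0; rewrite /cnormsq; move: (complex.Re _) (complex.Im _) => a b u0 v0.
rewrite !mxE /=; field.
by rewrite !gt_eqF.
Qed.

Lemma cnormsq_ge p v : closed_disk v -> (d p.1 - 1) ^+ 2 <= cnormsq p v.
Proof.
rewrite closed_diskE cnormsq_distsq => h; apply: distsq_ge h.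
by have := spaced_seq_ge2 p.1; lra.
Qed.

Lemma cnormsq_ge1 p v : closed_disk v -> 1 <= cnormsq p v.
Proof.
move=> /(@cnormsq_ge p); apply: le_trans; have := spaced_seq_ge2 p.1.
by move=> ?; apply: exprn_ege1; lra.
Qed.

End Maps.

(** * Lower bound for self-similar sets *)

Lemma powR_add_le (R : realType) (a b e : R) : 0 <= a -> 0 <= b -> 0 <= e ->
  (a + b) `^ e <= 2 `^ e * (a `^ e + b `^ e).
Proof.
move=> a0 b0 e0.
wlog ab : a b a0 b0 / a <= b.
  move=> h; have [|/ltW] := leP a b; first exact: h.
  by rewrite addrC [X in _ * X]addrC; exact: h.
apply: (@le_trans _ _ ((2 * b) `^ e)).
  by apply: ge0_ler_powR; rewrite ?nnegrE ?addr_ge0 ?mulr_ge0//; lra.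
by rewrite powRM// ler_wpM2l ?powR_ge0// lerDr powR_ge0.
Qed.

Lemma hausdorff_gauge_ge0 (R : realType) (n : nat) (e : R) (V : set 'rV[R]_n) : (0 <= hausdorff_gauge e V)%E.
Proof. by rewrite /hausdorff_gauge; case: ifP => // _; exact: poweR_ge0. Qed.

Section Similitudes.
Variable R : realType.
Local Notation E := 'rV[R]_2.
Variables (J : finType) (s : J -> E -> E) (r : J -> R) (lo hi : R).
Hypotheses (lo0 : 0 < lo) (lo1 : lo <= 1) (hi0 : 0 < hi) (hi1 : hi < 1) (rP : forall j, lo <= r j <= hi).
Hypothesis sB : forall j u v, s j u - s j v = r j *: (u - v).
Hypothesis s_closed : forall j v, closed_disk v -> closed_disk (s j v).
Hypothesis s_open : forall j v, enorm v < 1 -> enorm (s j v) < 1.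
Hypothesis s_disj : forall i j u v, enorm u < 1 -> enorm v < 1 -> s i u = s j v -> i = j.
Implicit Types (w x : seq J) (u v : E).

Let r_gt0 j : 0 < r j. Proof. by have /andP[h _] := rP j; exact: lt_le_trans h. Qed.

Definition wratio w := \prod_(j <- w) r j.

Lemma wratio_cons j w : wratio (j :: w) = r j * wratio w.
Proof. exact: big_cons. Qed.

Lemma wratio_gt0 w : 0 < wratio w.
Proof. by rewrite prodr_gt0. Qed.

Lemma wratio_le w : wratio w <= hi ^+ size w.
Proof.
elim: w => [|j w ih]; first by rewrite /wratio big_nil.
have /andP[_ rh] := rP j; have [rj0 w0] := (r_gt0 j, wratio_gt0 w).
by rewrite wratio_cons exprS ler_pM// ltW.
Qed.

Lemma word_mapB w u v : word_map s w u - word_map s w v = wratio w *: (u - v).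
Proof.
elim: w => [|j w ih] /=; first by rewrite /wratio big_nil scale1r.
by rewrite sB ih scalerA wratio_cons.
Qed.

Lemma word_mapE w v : word_map s w v = word_map s w 0 + wratio w *: v.
Proof. by rewrite -[LHS](subrK (word_map s w 0)) word_mapB subr0 addrC. Qed.

Lemma word_map_cat w x v : word_map s (w ++ x) v = word_map s w (word_map s x v).
Proof. by elim: w => //= j w ->. Qed.

Lemma word_map_closed w v : closed_disk v -> closed_disk (word_map s w v).
Proof. by move=> v1; elim: w => //= j w; exact: s_closed. Qed.

Lemma word_map_open w v : enorm v < 1 -> enorm (word_map s w v) < 1.
Proof. by move=> v1; elim: w => //= j w; exact: s_open. Qed.

(** Disjointness of the first-level images forces equal first letters, which then cancel because
    each similitude is injective. *)
Lemma overlap_comparable w x u v : enorm u < 1 -> enorm v < 1 ->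
  word_map s w u = word_map s x v -> prefix w x || prefix x w.
Proof.
move=> u1 v1; elim: w x => [|i w ih] [|j x] //= e.
have ij := s_disj (word_map_open w u1) (word_map_open x v1) e; subst j.
rewrite eqxx /=; apply: ih; apply/eqP; rewrite -subr_eq0.
have /eqP := sB i (word_map s w u) (word_map s x v).
by rewrite e subrr eq_sym scaler_eq0 gt_eqF.
Qed.

(* The shortest prefix of [w] of ratio at most [rho], or [w] itself if there is none. *)
Fixpoint cut (rho : R) w : seq J :=
  if 1 <= rho then [::] else if w is j :: w' then j :: cut (rho / r j) w' else [::].

Lemma cut_prefix rho w : prefix (cut rho w) w.
Proof.
by elim: w rho => [|j w ih] rho /=; case: ifP => //= _; rewrite eqxx ih.
Qed.

Lemma wratio_cut_le rho w : wratio w <= rho -> wratio (cut rho w) <= rho.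
Proof.
elim: w rho => [|j w ih] rho /=; case: ifP => //; rewrite /wratio ?big_nil// => _.
by rewrite !big_cons mulrC -ler_pdivlMr// => h; rewrite mulrC -ler_pdivlMr// ih.
Qed.

(** Without its last letter a nonempty cut has ratio above [rho], and that letter costs at most a
    factor [lo]. *)
Lemma wratio_cut_ge rho w : 0 < rho < 1 -> lo * rho <= wratio (cut rho w).
Proof.
have lo_le a b : a < 1 -> lo <= b -> lo * a <= b.
  by move=> a1; apply: le_trans; rewrite ger_pMr// ltW.
elim: w rho => [|j w ih] rho /andP[rho0 rho1] /=; rewrite [1 <= rho]leNgt rho1 /=.
  by rewrite /wratio big_nil lo_le.
have /andP[loj _] := rP j.
rewrite wratio_cons; have [h|h] := ltP (rho / r j) 1.
  rewrite -ler_pdivrMl// mulrC -mulrA ih// h andbT.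
  by rewrite divr_gt0.
by case: (w) => [|i w'] /=; rewrite h /wratio big_nil mulr1 lo_le.
Qed.

(** A cut stops at the first prefix of ratio at most [rho], so one cut cannot properly extend
    another: the cuts form an antichain. *)
Lemma cut_comparable rho w x : wratio w <= rho -> wratio x <= rho ->
  prefix (cut rho w) (cut rho x) -> cut rho w = cut rho x.
Proof.
elim: w rho x => [|i w ih] rho x /=.
  rewrite /wratio big_nil => rho1 _; rewrite rho1.
  by case: x => [|j x] /=; rewrite rho1.
rewrite wratio_cons; case: (leP 1 rho) => h.
  by case: x => [|j x] /= _ _ _; rewrite h.
case: x => [|j x] /=.
  by rewrite {2}/wratio big_nil => _ /(lt_le_trans h); rewrite ltxx.
rewrite [1 <= rho]leNgt h /= wratio_cons => hw hx /andP[/eqP ij].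
rewrite -ij in hx *; move=> hp; congr cons; apply: ih hp.
  by rewrite ler_pdivlMr// mulrC.
by rewrite ler_pdivlMr// mulrC.
Qed.

(** * Bernoulli weights on words and the mass near a point *)

Section Mass.
Variables (e : R) (pr : J -> R).
Hypotheses (pr_ge0 : forall j, 0 <= pr j) (pr_le : forall j, pr j <= r j `^ e)
  (pr1 : \sum_j pr j = 1) (e0 : 0 < e).

(** The mass of the cylinder of [w] for the Bernoulli measure with weights [pr]; finite sums over
    words replace the measure itself. *)
Definition wmass w := \prod_(j <- w) pr j.

Lemma wmass_cons j w : wmass (j :: w) = pr j * wmass w.
Proof. exact: big_cons. Qed.

Lemma wmass_ge0 w : 0 <= wmass w.
Proof. by rewrite prodr_ge0. Qed.

Lemma wmass_le w : wmass w <= wratio w `^ e.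
Proof.
elim: w => [|j w ih]; first by rewrite /wmass /wratio !big_nil powR1.
rewrite wmass_cons wratio_cons (powRM _ (ltW (r_gt0 j)) (ltW (wratio_gt0 w))).
by rewrite ler_pM ?wmass_ge0.
Qed.

Fixpoint words L : seq (seq J) :=
  if L is L'.+1 then [seq j :: x | j <- enum J, x <- words L'] else [:: [::]].

Lemma mem_words L x : (x \in words L) = (size x == L).
Proof.
elim: L x => [|L ih] x /=; first by rewrite inE size_eq0.
apply/allpairsP/idP => [[[j y] /= [_ hy ->]]|].
  by rewrite eqSS -ih.
by case: x => // j x /=; rewrite eqSS -ih => h; exists (j, x); rewrite mem_enum.
Qed.

Lemma big_wordsS L (P : pred (seq J)) (F : seq J -> R) :
  \sum_(x <- words L.+1 | P x) F x = \sum_j \sum_(x <- words L | P (j :: x)) F (j :: x).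
Proof.
rewrite big_mkcond big_allpairs_dep /= big_enum /=.
by apply: eq_bigr => j _; rewrite [RHS]big_mkcond.
Qed.

Lemma sum_wmass L : \sum_(x <- words L) wmass x = 1.
Proof.
elim: L => [|L ih]; first by rewrite big_seq1 /wmass big_nil.
rewrite big_wordsS -[RHS]pr1; apply: eq_bigr => j _.
by under eq_bigr do rewrite wmass_cons; rewrite -mulr_sumr ih mulr1.
Qed.

(** Equality holds when [L] is at least the length of [w]; for smaller [L] the sum is empty. *)
Lemma sum_wmass_prefix w L : \sum_(x <- words L | prefix w x) wmass x <= wmass w.
Proof.
elim: w L => [|j w ih] L.
  by rewrite (eq_bigl xpredT) ?sum_wmass /wmass ?big_nil// => x; rewrite prefix0s.
case: L => [|L]; first by rewrite big_mkcond big_seq1 wmass_ge0.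
rewrite big_wordsS (bigD1 j)//= [X in _ + X]big1 ?addr0.
  rewrite (eq_bigl (prefix w)); last by move=> x; rewrite /= eqxx.
  under eq_bigr do rewrite wmass_cons.
  by rewrite -mulr_sumr wmass_cons ler_wpM2l.
by move=> i ij; rewrite big_pred0// => x /=; rewrite eq_sym (negbTE ij).
Qed.

(** The number of intervals of length [lo * rho / 2] that suffice for an interval of length
    [4 * rho]; it does not depend on [rho]. *)
Definition ncells : nat := (Num.truncn (8 / lo)).+1.

(** The estimate of the mass distribution principle. The words are grouped by the grid cell of the
    centre of their cut. Two cuts with centres in one cell overlap, hence coincide, so each cell
    carries the mass of at most one cylinder of ratio at most [rho]. *)
Lemma sum_wmass_ball (rho : R) (u0 : E) L (B : pred (seq J)) : 0 < rho < 1 ->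
  (forall x, size x = L -> wratio x <= rho) ->
  (forall x, size x = L -> B x ->
    exists2 v, closed_disk v & enorm (word_map s x v - u0) <= rho) ->
  \sum_(x <- words L | B x) wmass x <= (ncells * ncells)%:R * rho `^ e.
Proof.
move=> /andP[rho0 rho1] small hit.
pose g := lo * rho / 2.
have g0 : 0 < g by rewrite divr_gt0 ?mulr_gt0.
pose a (x : seq J) (i : 'I_2) := ((word_map s (cut rho x) 0 - u0) 0 i + 2 * rho) / g.
pose cell x : 'I_ncells * 'I_ncells :=
  (inord (Num.truncn (a x 0)), inord (Num.truncn (a x 1))).
have aP x i : size x = L -> B x -> 0 <= a x i <= 8 / lo.
  move=> xL Bx; have [v v1 hv] := hit x xL Bx.
  (* One [rho] for the distance of the hit point to [u0], one for the radius of the image of the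
     disk under the cut. *)
  have hc : `|(word_map s (cut rho x) 0 - u0) 0 i| <= 2 * rho.
    have /prefixP[y xE] := cut_prefix rho x.
    have yE : word_map s x v = word_map s (cut rho x) (word_map s y v).
      by rewrite {1}xE word_map_cat.
    have h1 := le_trans (coord_le_enorm _ i) hv.
    have h2 : `|(word_map s (cut rho x) 0 - word_map s x v) 0 i| <= rho.
      apply: (le_trans (coord_le_enorm _ i)); rewrite yE word_mapB enormZ sub0r enormN.
      rewrite gtr0_norm ?wratio_gt0// -[leRHS]mulr1.
      apply: ler_pM; rewrite ?enorm_ge0 ?(ltW (wratio_gt0 _))//.
        by apply: wratio_cut_le; exact: small.
      by rewrite -closed_diskP; apply: word_map_closed.
    rewrite -(subrK (word_map s x v) (word_map s (cut rho x) 0)) -addrA mxE.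
    apply: (le_trans (ler_normD _ _)); move: h1 h2; lra.
  move: hc; rewrite ler_norml => /andP[l1 l2].
  rewrite /a divr_ge0 ?(ltW g0)//=; last by lra.
  rewrite ler_pdivrMr// /g.
  have -> : 8 / lo * (lo * rho / 2) = 4 * rho by field; rewrite gt_eqF.
  lra.
have cellP x y i : size x = L -> B x -> size y = L -> B y ->
    cell x = cell y -> `|(word_map s (cut rho x) 0 - word_map s (cut rho y) 0) 0 i| < g.
  move=> xL Bx yL By cxy.
  have trE : Num.truncn (a x i) = Num.truncn (a y i).
    have lt z k : size z = L -> B z -> (Num.truncn (a z k) < ncells)%N.
      by move=> zL Bz; rewrite ltnS le_truncn//; have /andP[] := aP z k zL Bz.
    case: cxy => /(congr1 val) /= h0 /(congr1 val) /= h1.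
    rewrite !inordK ?lt// in h0 h1.
    by case: (unliftP 0 i) => [j ->|-> //]; rewrite (ord1 j) (_ : lift 0 0 = 1)//; apply/val_inj.
  have /andP[ax0 _] := aP x i xL Bx; have /andP[ay0 _] := aP y i yL By.
  have := truncn_itv ax0; have := truncn_itv ay0; rewrite trE.
  set m := Num.truncn _; rewrite -natr1 => /andP[y1 y2] /andP[x1 x2].
  have : `|a x i - a y i| < 1 by rewrite ltr_norml; lra.
  have -> : a x i - a y i =
      (word_map s (cut rho x) 0 - word_map s (cut rho y) 0) 0 i / g.
    by rewrite /a -mulrBl !mxE; congr (_ / _); ring.
  by rewrite normrM normfV (gtr0_norm g0) ltr_pdivrMr// mul1r.
have cutE x y : size x = L -> B x -> size y = L -> B y ->
    cell x = cell y -> cut rho x = cut rho y.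
  move=> xL Bx yL By cxy.
  have lox : lo * rho <= wratio (cut rho x) by apply: wratio_cut_ge; rewrite rho0.
  have dist : enorm (word_map s (cut rho y) 0 - word_map s (cut rho x) 0) <
      wratio (cut rho x).
    rewrite enorm_distC; apply: enorm_lt; first exact: wratio_gt0.
      apply: lt_le_trans (cellP x y 0 xL Bx yL By cxy) _.
      by rewrite /g ler_pM2r ?invr_gt0.
    apply: lt_le_trans (cellP x y 1 xL Bx yL By cxy) _.
    by rewrite /g ler_pM2r ?invr_gt0.
  (* The preimage under the cut of [x] of the centre of the cut of [y]; since it has norm below 1,
     the two cuts are comparable. *)
  pose v := (wratio (cut rho x))^-1 *:
    (word_map s (cut rho y) 0 - word_map s (cut rho x) 0).
  have v1 : enorm v < 1.
    rewrite enormZ gtr0_norm ?invr_gt0 ?wratio_gt0//.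
    by rewrite mulrC ltr_pdivrMr ?wratio_gt0// mul1r.
  have e1 : word_map s (cut rho x) v = word_map s (cut rho y) 0.
    rewrite word_mapE scalerA mulfV ?gt_eqF ?wratio_gt0// scale1r.
    by rewrite addrC subrK.
  have z1 : enorm (0 : E) < 1 by rewrite enorm0.
  have [] := orP (overlap_comparable v1 z1 e1).
    by apply: cut_comparable; exact: small.
  by move=> h; apply/esym/cut_comparable; [exact: small|exact: small|].
rewrite (partition_big cell predT)//=.
apply: (@le_trans _ _ (\sum_(c : 'I_ncells * 'I_ncells) rho `^ e)); last first.
  by rewrite sumr_const card_prod card_ord mulr_natl.
apply: ler_sum => c _.
(* All words counted in one cell extend the same cut, that of [x0]. *)
have [/hasP[x0]|/hasPn no] := boolP (has (fun x => B x && (cell x == c)) (words L)).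
  rewrite mem_words => /eqP x0L /andP[Bx0 /eqP cx0].
  apply: (@le_trans _ _ (wmass (cut rho x0))).
    apply: le_trans (sum_wmass_prefix (cut rho x0) L).
    rewrite big_mkcond [leRHS]big_mkcond /= [leLHS]big_seq [leRHS]big_seq.
    apply: ler_sum => x; rewrite mem_words => /eqP xL.
    case: ifPn => [/andP[Bx /eqP cx]|_]; last by case: ifP => // _; rewrite wmass_ge0.
    by rewrite -(cutE x x0 xL Bx x0L Bx0) ?cut_prefix// cx cx0.
  apply: (le_trans (wmass_le _)).
  apply: ge0_ler_powR; rewrite ?nnegrE ?(ltW e0) ?(ltW rho0) ?(ltW (wratio_gt0 _))//.
  exact/wratio_cut_le/small.
rewrite big_seq_cond big_pred0 ?powR_ge0// => x.
by apply/negP => /andP[/no /negP].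
Qed.

(* [overlap x y] is the Bernoulli measure of the sequences extending both [x] and [y]. *)
Fixpoint overlap x y : R :=
  match x, y with
  | [::], _ => wmass y
  | _, [::] => wmass x
  | i :: x', j :: y' => if i == j then pr i * overlap x' y' else 0
  end.

Lemma overlap_nil x : overlap x [::] = wmass x.
Proof. by case: x. Qed.

Lemma overlap_diag x : overlap x x = wmass x.
Proof.
by elim: x => [|i x ih] /=; rewrite ?eqxx ?ih ?wmass_cons// /wmass big_nil.
Qed.

Lemma overlap_ge0 x y : 0 <= overlap x y.
Proof.
elim: x y => [|i x ih] [|j y] /=; rewrite ?wmass_ge0//.
by case: ifP => // _; rewrite mulr_ge0.
Qed.

Lemma sum_wmass_rcons y : \sum_j wmass (rcons y j) = wmass y.
Proof.
rewrite (eq_bigr (fun j => wmass y * pr j)); first by rewrite -mulr_sumr pr1 mulr1.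
by move=> j _; rewrite /wmass -cats1 big_cat big_seq1.
Qed.

Lemma overlap_rcons x y : overlap x y = \sum_j overlap x (rcons y j).
Proof.
elim: x y => [|i x ih] y; first exact/esym/sum_wmass_rcons.
case: y => [|j y] /=.
  rewrite (bigD1 i)//= eqxx overlap_nil wmass_cons big1 ?addr0// => j /negbTE.
  by rewrite eq_sym => ->.
by case: ifP => _; rewrite ?big1_eq// ih mulr_sumr.
Qed.

(** The mass, inside the cylinder of [y], of the sequences whose prefix of length [L] satisfies
    [B]. *)
Definition hit_mass (L : nat) (B : pred (seq J)) y : R :=
  \sum_(x <- words L | B x) overlap x y.

Lemma hit_mass_ge0 L B y : 0 <= hit_mass L B y.
Proof. by apply: sumr_ge0 => x _; exact: overlap_ge0. Qed.

Lemma hit_mass_rcons L B y : hit_mass L B y = \sum_j hit_mass L B (rcons y j).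
Proof.
rewrite /hit_mass exchange_big /=; apply: eq_bigr => x _; exact: overlap_rcons.
Qed.

Lemma hit_mass_self L (B : pred (seq J)) x : size x = L -> B x -> wmass x <= hit_mass L B x.
Proof.
move=> xL Bx; rewrite /hit_mass (big_rem x) /=; last by rewrite mem_words xL.
by rewrite Bx overlap_diag lerDl sumr_ge0// => z _; exact: overlap_ge0.
Qed.

(* Greedy choice of the letters, keeping the total hit mass below the mass of the
   cylinder. *)
Lemma avoiding_sequence (L : nat -> nat) (B : nat -> pred (seq J)) :
  (\sum_(0 <= k <oo) (\sum_(x <- words (L k) | B k x) wmass x)%:E < 1)%E ->
  exists om : nat -> J, forall k, ~~ B k (mkseq om (L k)).
Proof.
move=> lt1.
pose Phi y : \bar R := (\sum_(0 <= k <oo) (hit_mass (L k) (B k) y)%:E)%E.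
have hm0 y k : (0 <= (hit_mass (L k) (B k) y)%:E)%E by rewrite lee_fin hit_mass_ge0.
have step y : exists j, (Phi y < (wmass y)%:E)%E ->
    (Phi (rcons y j) < (wmass (rcons y j))%:E)%E.
  (* If every letter failed, summing over the letters would give [wmass y <= Phi y], since both
     sides are additive over the one-letter extensions of [y]. *)
  apply: contrapT => /forallNP no.
  have [j0 _] : exists j0 : J, True.
    apply: contrapT => /forallNP noj; have := pr1; rewrite big1 => [|j]; last by have := noj j.
    by move=> /esym/eqP; rewrite oner_eq0.
  have /not_implyP[lv _] := no j0.
  have : (\sum_j (wmass (rcons y j))%:E <= \sum_j Phi (rcons y j))%E.
    by apply: lee_sum => j _; have /not_implyP[_ /negP] := no j; rewrite -leNgt.
  rewrite sumEFin sum_wmass_rcons /Phi -nneseries_sum//.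
  under eq_eseriesr do rewrite sumEFin -hit_mass_rcons.
  by rewrite leNgt => /negP; apply.
have [next nextP] := choice step.
pose W := fix W n := if n is n'.+1 then rcons (W n') (next (W n')) else [::].
pose om n := next (W n).
have WE n : mkseq om n = W n by elim: n => //= n ih; rewrite mkseqS ih.
have PhiW n : (Phi (W n) < (wmass (W n))%:E)%E.
  elim: n => [|n ih] /=; last exact: nextP.
  rewrite /Phi /wmass big_nil.
  by under eq_eseriesr do rewrite /hit_mass (eq_bigr _ (fun x _ => overlap_nil x)).
(* A prefix of length [L k] satisfying [B k] has its whole cylinder hit, which makes [Phi] at least
   its mass. *)
exists om => k; apply/negP => Bk; have := PhiW (L k).
rewrite -WE ltNge => /negP; apply.
apply: (@le_trans _ _ (hit_mass (L k) (B k) (mkseq om (L k)))%:E).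
  by rewrite lee_fin hit_mass_self// size_mkseq.
by rewrite /Phi (@nneseriesD1 _ _ k)// leeDl// nneseries_ge0.
Qed.

End Mass.

(** * Points of the limit set and the cost of covers *)

Hypothesis disk_compact : compact (@closed_disk R).

(** A cluster point of the images of 0 works for every [N] at once: from index [N] on, these images
    stay in the closed ball that is the image of the disk under the first [N] letters. *)
Lemma coded_point (om : nat -> J) : exists z, forall N,
  exists2 v, closed_disk v & z = word_map s (mkseq om N) v.
Proof.
pose z_ N := word_map s (mkseq om N) 0.
have zD N : closed_disk (z_ N) by apply: word_map_closed; exact: closed_disk0.
have [z [_ zc]] : (@closed_disk R) `&` cluster (z_ @ \oo) !=set0.
  by apply: disk_compact; exists 0%N => // N _; exact: zD.
exists z => N; set w := mkseq om N.
pose v := (wratio w)^-1 *: (z - word_map s w 0).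
exists v; last by rewrite word_mapE scalerA mulfV ?gt_eqF ?wratio_gt0// scale1r addrC subrK.
rewrite closed_diskP enormZ gtr0_norm ?invr_gt0 ?wratio_gt0//.
rewrite mulrC ler_pdivrMr ?wratio_gt0// mul1r.
pose T := [set y : E | enorm (y - word_map s w 0) <= wratio w].
have Tc : closed T.
  have cE : continuous (fun y : E => enorm (y - word_map s w 0)).
    move=> y; apply: (@continuous_comp _ _ _ (fun y : E => y - word_map s w 0) (@enorm R 2)).
      exact: (@continuousB _ _ _ (@id E) (fun=> word_map s w 0) y (@cvg_id _ _) (@cst_continuous _ _ _ y)).
    exact: enorm_continuous.
  rewrite (_ : T = (fun y : E => enorm (y - word_map s w 0)) @^-1` [set t | t <= wratio w])//.
  by apply: closed_comp; [move=> y _; exact: cE|exact: closed_le].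
suff : closure T z by rewrite -((closure_id T).1 Tc).
move: zc; rewrite clusterE => /(_ T); apply.
exists N => // n /= nN; rewrite /T /=.
have -> : z_ n = word_map s w (word_map s [seq om i | i <- iota N (n - N)] 0).
  by rewrite -word_map_cat /z_ /w /mkseq -map_cat -{1}(subnKC nN) iotaD.
rewrite word_mapB subr0 enormZ gtr0_norm ?wratio_gt0// -[leRHS]mulr1.
rewrite ler_pM2l ?wratio_gt0// -closed_diskP; apply: word_map_closed; exact: closed_disk0.
Qed.

(** If a cover were too cheap, the words whose images meet its members would have total mass below
    1; a sequence avoiding all of them codes an uncovered point of the limit set. Diameters at most
    1/4 leave room for a radius [rho] below 1. *)
Lemma similitudes_cover (e : R) : 0 < e -> 1 <= \sum_j r j `^ e ->
  exists2 c, 0 < c & forall U : nat -> set E,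
    limit_set (@closed_disk R) s `<=` \bigcup_k U k ->
    (forall k, (diam (U k) <= (4^-1)%:E)%E) ->
    (c%:E <= \sum_(0 <= k <oo) hausdorff_gauge e (U k))%E.
Proof.
move=> e0 S1; set S := \sum_j _ in S1.
have S0 : 0 < S by exact: lt_le_trans S1.
pose pr j := r j `^ e / S.
have pr_ge0 j : 0 <= pr j by rewrite divr_ge0 ?powR_ge0 ?ltW.
have pr_le j : pr j <= r j `^ e.
  by rewrite ler_pdivrMr// ler_peMr ?powR_ge0.
have pr1 : \sum_j pr j = 1 by rewrite -mulr_suml divff// gt_eqF.
pose A := (ncells * ncells)%:R * 2 `^ e : R.
have A0 : 0 < A by rewrite mulr_gt0 ?powR_gt0// ltr0n.
(* With a cover of cost below 1/(2A), the total mass stays below A (1/(2A) + 1/(4A)) = 3/4. *)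
pose eps := (4 * A)^-1.
have eps0 : 0 < eps by rewrite invr_gt0 mulr_gt0.
exists (2 * A)^-1; first by rewrite invr_gt0 mulr_gt0.
move=> U JU dU; rewrite leNgt; apply/negP => small.
have claim k : exists LB : nat * pred (seq J),
    ((\sum_(x <- words LB.1 | LB.2 x) wmass pr x)%:E <=
      A%:E * (hausdorff_gauge e (U k) + (eps / (2 ^ k.+1)%:R)%:E))%E /\
    forall x, size x = LB.1 -> (exists2 v, closed_disk v & U k (word_map s x v)) -> LB.2 x.
  have ek0 : 0 < eps / (2 ^ k.+1)%:R by rewrite divr_gt0// ltr0n expn_gt0.
  have [Uk0|/set0P[u0 Uu0]] := eqVneq (U k) set0.
    exists (0%N, pred0 : pred (seq J)); split => /=.
      by rewrite big_pred0// mule_ge0 ?lee_fin ?(ltW A0)// adde_ge0 ?hausdorff_gauge_ge0// lee_fin ltW.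
    by move=> x _ [v _]; rewrite Uk0.
  have diam_ge u v : U k u -> U k v -> ((enorm (u - v))%:E <= diam (U k))%E.
    by move=> Uu Uv; apply: ereal_sup_ubound; exists (u, v).
  have d0 : (0 <= diam (U k))%E.
    by apply: le_trans (diam_ge u0 u0 Uu0 Uu0); rewrite lee_fin enorm_ge0.
  have dfin : diam (U k) \is a fin_num.
    by rewrite ge0_fin_numE// (le_lt_trans (dU k))// ltry.
  pose D := fine (diam (U k)).
  have DE : diam (U k) = D%:E by rewrite fineK.
  have D0 : 0 <= D by rewrite -lee_fin -DE.
  have D4 : D <= 4^-1 by rewrite -lee_fin -DE.
  pose eta := Num.min 4^-1 ((eps / (2 ^ k.+1)%:R) `^ e^-1).
  have eta0 : 0 < eta by rewrite lt_min powR_gt0// invr_gt0 ltr0n.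
  have eta4 : eta <= 4^-1 by rewrite ge_min lexx.
  have etae : eta `^ e <= eps / (2 ^ k.+1)%:R.
    have -> : eps / (2 ^ k.+1)%:R = ((eps / (2 ^ k.+1)%:R) `^ e^-1) `^ e.
      by rewrite -powRrM mulVf ?lt0r_neq0// powRr1// ltW.
    by apply: ge0_ler_powR; rewrite ?nnegrE ?powR_ge0 ?(ltW eta0) ?(ltW e0)// ge_min lexx orbT.
  (* All words of length [L] then have ratio at most the chosen radius. *)
  have [L hiL] : exists L, hi ^+ L <= D + eta.
    have : hi ^+ n @[n --> \oo] --> 0 by apply: cvg_expr; rewrite ger0_norm ?ltW.
    move=> /cvgrPdist_lt/(_ (D + eta)); rewrite ltr_wpDl// => /(_ isT)[L _ /(_ L (leqnn L))].
    by rewrite sub0r normrN => /ltW h; exists L; apply: le_trans h; exact: ler_norm.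
  exists (L, fun x => `[< exists2 v, closed_disk v & U k (word_map s x v) >]); split => /=; last first.
    by move=> x _ h; apply/asboolP.
  have rho01 : 0 < D + eta < 1 by rewrite ltr_wpDl//=; lra.
  apply: (@le_trans _ _ ((ncells * ncells)%:R * (D + eta) `^ e)%:E).
    rewrite lee_fin; apply: (@sum_wmass_ball e pr pr_ge0 pr_le pr1 e0 _ u0) => //.
      by move=> x xL; apply: le_trans hiL; rewrite -xL; exact: wratio_le.
    move=> x xL /asboolP[v v1 Uv]; exists v => //.
    have := diam_ge _ _ Uv Uu0; rewrite DE lee_fin => /le_trans; apply.
    by rewrite lerDl ltW.
  rewrite /hausdorff_gauge ifF; last by apply/negbTE/set0P; exists u0.
  rewrite DE /= -EFinD -EFinM lee_fin /A -mulrA ler_wpM2l//.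
  apply: (le_trans (powR_add_le D0 (ltW eta0) (ltW e0))).
  by rewrite ler_wpM2l ?powR_ge0// lerD2l.
have [LB LBP] := choice claim.
have total : (\sum_(0 <= k <oo) (\sum_(x <- words (LB k).1 | (LB k).2 x) wmass pr x)%:E < 1)%E.
  apply: (@le_lt_trans _ _ (\sum_(0 <= k <oo)
      (A%:E * (hausdorff_gauge e (U k) + (eps / (2 ^ k.+1)%:R)%:E)))%E).
    apply: lee_nneseries => k _; last by have [] := LBP k.
    by move=> _; rewrite lee_fin sumr_ge0// => x _; exact: wmass_ge0.
  rewrite nneseriesZl; last first.
    move=> k _; rewrite adde_ge0 ?hausdorff_gauge_ge0// lee_fin divr_ge0 ?ltW//.
  apply: (@le_lt_trans _ _ (A%:E * (\sum_(0 <= k <oo) hausdorff_gauge e (U k) + eps%:E))%E).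
    rewrite lee_pmul2l ?lte_fin//; apply: epsilon_trick => [k|]; last exact: ltW.
    exact: hausdorff_gauge_ge0.
  apply: (@lt_trans _ _ (A%:E * ((2 * A)^-1%:E + eps%:E))%E).
    by rewrite lte_pmul2l ?lte_fin// lteD2rE.
  rewrite -EFinD -EFinM lte_fin /eps.
  have -> : A * ((2 * A)^-1 + (4 * A)^-1) = 3 / 4 by field; rewrite gt_eqF.
  lra.
have [om omP] := avoiding_sequence pr_ge0 pr1 total.
have [z zP] := coded_point om.
have [k _ Ukz] : (\bigcup_k U k) z.
  apply: JU; exists om => // N _; have [v v1 ->] := zP N.
  by exists v.
have /negP := omP k; apply.
apply: (LBP k).2; first exact: size_mkseq.
by have [v v1 zE] := zP (LB k).1; exists v; rewrite -?zE.
Qed.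

End Similitudes.

(** * Bounds on Hausdorff dimension from covers *)

Section HausdorffDim.
Variable R : realType.
Local Notation E := 'rV[R]_2.
Implicit Types (A V : set E) (s t e : R).

Lemma diam_ge0 V : V !=set0 -> (0 <= diam V)%E.
Proof.
move=> [u Vu]; apply: le_ereal_sup_tmp; exists 0%E => //.
by exists (u, u) => //=; rewrite subrr enorm0.
Qed.

Lemma hausdorff_gauge_le s e V : s <= e -> 0 < e -> (diam V <= 1%E)%E ->
  (hausdorff_gauge e V <= hausdorff_gauge s V)%E.
Proof.
move=> se e0 dV; rewrite /hausdorff_gauge; case: eqVneq => // /set0P V0.
have d0 := diam_ge0 V0; move: d0 dV; case: (diam V) => [D||]//.
rewrite !lee_fin => D0 D1.
move: D0; rewrite le_eqVlt => /predU1P[<-|D0].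
  by rewrite powR0 ?powR_ge0// gt_eqF.
by apply: ger_powR => //; rewrite D0.
Qed.

(** For s < e, sets of diameter at most 1 have a larger gauge at s than at e. One scale is enough,
    the measure being a supremum over scales. *)
Lemma hausdorff_dim_ge A e c : 0 < e -> 0 < c ->
  (forall U : nat -> set E, A `<=` \bigcup_k U k ->
    (forall k, (diam (U k) <= (4^-1)%:E)%E) ->
    (c%:E <= \sum_(0 <= k <oo) hausdorff_gauge e (U k))%E) ->
  (e%:E <= hausdorff_dim A)%E.
Proof.
move=> e0 c0 cover; apply: le_ereal_inf_tmp => _ [s [s0 Hs] <-].
rewrite lee_fin leNgt; apply/negP => se.
suff : (c%:E <= hausdorff_measure s A)%E by rewrite Hs lee_fin leNgt c0.
apply: le_ereal_sup_tmp; exists (hausdorff_content s 4^-1 A).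
  by exists (4^-1) => //=; rewrite invr_gt0.
apply: le_ereal_inf_tmp => _ [U [AU dU] <-].
apply: (le_trans (cover U AU dU)); apply: lee_nneseries => k _.
  by move=> _; exact: hausdorff_gauge_ge0.
apply: hausdorff_gauge_le => //; first exact: ltW.
by apply: (le_trans (dU k)); rewrite lee_fin; lra.
Qed.

Lemma hausdorff_dim_le A t : 0 <= t ->
  (forall eps delta, 0 < eps -> 0 < delta -> exists U : nat -> set E,
    [/\ A `<=` \bigcup_k U k, forall k, (diam (U k) <= delta%:E)%E &
        (\sum_(0 <= k <oo) hausdorff_gauge t (U k) <= eps%:E)%E]) ->
  (hausdorff_dim A <= t%:E)%E.
Proof.
move=> t0 cover; apply: ereal_inf_lbound; exists t => //; split => //.
apply/eqP; rewrite eq_le; apply/andP; split; last first.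
  apply: le_ereal_sup_tmp; exists (hausdorff_content t 1 A); first by exists 1 => //=.
  by apply: le_ereal_inf_tmp => _ [U _ <-]; apply: nneseries_ge0 => k _ _; exact: hausdorff_gauge_ge0.
apply: ge_ereal_sup => _ [delta /= delta0 <-].
apply/lee_addgt0Pr => eps eps0; rewrite add0e.
have [U [AU dU SU]] := cover eps delta eps0 delta0.
by apply: le_trans SU; apply: ereal_inf_lbound; exists U.
Qed.

End HausdorffDim.

(** * Lower bound for the dimension of the affine system *)

Section AffineSystem.
Variables (R : realType) (d : nat -> R).
Hypotheses (d_spaced : spaced_seq d) (F_CIFS : is_CIFS (@closed_disk R) (@F_family R d 4)).
Local Notation E := 'rV[R]_2.

Let d2 := spaced_seq_ge2 d_spaced.

Lemma ratio_gt0 n : 0 < ratio d n.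
Proof. by have dn := d2 n; rewrite invr_gt0 subr_gt0 exprn_egt1//; lra. Qed.

Lemma ratio_le_third n : ratio d n <= 3^-1.
Proof.
have dn := d2 n; have : 2 * 2 <= d n * d n by apply: ler_pM.
rewrite -expr2 => dn2; rewrite /ratio lef_pV2 ?posrE//; lra.
Qed.

Lemma ratio_nincr m n : (m <= n)%N -> ratio d n <= ratio d m.
Proof.
move=> mn; have dmn : d m <= d n.
  elim: n mn => [|n ih]; first by rewrite leqn0 => /eqP ->.
  rewrite leq_eqVlt => /predU1P[-> //|/ih h]; apply: (le_trans h).
  by have := d_spaced.2 n; rewrite -subr_ge0 => ?; lra.
have dm := d2 m; have dm4 : 2 * 2 <= d m * d m by apply: ler_pM.
have : d m * d m <= d n * d n by apply: ler_pM => //; lra.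
rewrite -!expr2 in dm4 *; move=> h.
by rewrite /ratio lef_pV2 ?posrE ?lerD2r//; lra.
Qed.

(** The maps with index below [M] form a finite system of similitudes whose limit set lies in that
    of F, so covers of the latter cover it too. *)
Lemma F_family_dim_ge M e : 0 < e -> 1 <= \sum_(n < M) 4 * ratio d n `^ e ->
  (e%:E <= hausdorff_dim (limit_set (@closed_disk R) (@F_family R d 4)))%E.
Proof.
move=> e0 Me.
have [[disk_compact _ _ F_disk _] osc _ _] := F_CIFS.
pose J : finType := ('I_M * 'I_4)%type.
pose emb (p : J) : nat * 'I_4 := (nat_of_ord p.1, p.2).
pose s (p : J) : E -> E := F_family d (emb p).
pose r (p : J) : R := ratio d p.1.
have embI p q : emb p = emb q -> p = q.
  by case: p q => [m i] [n j] [/val_inj -> ->].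
have sB p u v : s p u - s p v = r p *: (u - v).
  by rewrite /s !F_familyE -scalerBr opprD addrACA subrr addr0.
have s_closed p v : closed_disk v -> closed_disk (s p v).
  by move=> v1; have [h _] := F_disk (emb p); apply: h; exists v.
(* Moving [v] by [tau *: s p v] stays in the disk and multiplies the image by [1 + r p * tau], so
   the image cannot lie on the unit circle. *)
have s_open p v : enorm v < 1 -> enorm (s p v) < 1.
  move=> v1; have /closed_diskP y1 : closed_disk (s p v).
    by apply: s_closed; rewrite closed_diskP ltW.
  pose tau := 1 - enorm v.
  have tau0 : 0 < tau by rewrite subr_gt0.
  have /closed_diskP : closed_disk (s p (v + tau *: s p v)).
    apply: s_closed; rewrite closed_diskP; apply: (le_trans (enorm_triangle _ _)).
    rewrite enormZ gtr0_norm// -lerBrDl -/tau.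
    by rewrite ger_pMr.
  have -> : s p (v + tau *: s p v) = (1 + r p * tau) *: s p v.
    have := sB p (v + tau *: s p v) v; rewrite addrAC subrr add0r => /eqP.
    by rewrite subr_eq => /eqP ->; rewrite scalerDl scale1r scalerA addrC.
  have rt0 : 0 < r p * tau by rewrite mulr_gt0// ratio_gt0.
  rewrite enormZ gtr0_norm; last by lra.
  by have := enorm_ge0 (s p v); nra.
have s_disj p q u v : enorm u < 1 -> enorm v < 1 -> s p u = s q v -> p = q.
  move=> u1 v1 uv; apply: contrapT => /(contra_not (@embI p q)) pq.
  suff : set0 (s p u) by [].
  rewrite -(osc (emb p) (emb q) pq); split.
    by exists u => //; exact: open_disk_interior.
  by rewrite uv; exists v => //; exact: open_disk_interior.
have lo0 : 0 < ratio d M := ratio_gt0 M.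
have rP p : ratio d M <= r p <= 3^-1.
  by rewrite ratio_nincr ?(ltnW (ltn_ord _))//= ratio_le_third.
have hi0 : 0 < 3^-1 :> R by rewrite invr_gt0.
have hi1 : 3^-1 < 1 :> R by lra.
have lo1 : ratio d M <= 1 by have := ratio_le_third M; lra.
have re : 1 <= \sum_p r p `^ e.
  apply: (le_trans Me).
  rewrite -(pair_bigA _ (fun (i : 'I_M) (j : 'I_4) => r (i, j) `^ e)) /=.
  by apply: ler_sum => n _; rewrite /r /= sumr_const card_ord mulr_natl.
have [c c0 cover] := similitudes_cover lo0 lo1 hi0 hi1 rP sB s_closed s_open
  s_disj disk_compact e0 re.
apply: (hausdorff_dim_ge e0 c0) => U FU dU; apply: cover => // z [om _ omz].
apply: FU; exists (emb \o om) => // N N0; have [v v1 <-] := omz N N0.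
exists v => //; rewrite /mkseq map_comp.
by elim: (map om _) => //= p w ->.
Qed.

End AffineSystem.

(** * Pressure and dimension of the inversion system *)

Section Sums.
Variable R : realType.

Lemma esum_cmul_le (T : choiceType) (A : set T) (a : T -> \bar R) (c : R) : 0 <= c ->
  (forall i, 0 <= a i)%E ->
  (\esum_(i in A) (c%:E * a i) <= c%:E * \esum_(i in A) a i)%E.
Proof.
move=> c0 a0; apply: ge_ereal_sup => _ [B [finB BA] <-].
rewrite -ge0_mule_fsumr// lee_wpmul2l ?lee_fin//.
by apply: ereal_sup_ubound; exists B.
Qed.

(** Covers are indexed by [nat] but the sums run over words; indices that code no word contribute
    0. *)
Lemma nneseries_pickle_inv (T : countType) (a : T -> \bar R) : (forall i, 0 <= a i)%E ->
  (\sum_(0 <= k <oo) oapp a 0 (pickle_inv k) = \esum_(i in [set: T]) a i)%E.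
Proof.
move=> a0; rewrite nneseries_esumT; last by move=> k; case: pickle_inv => /=.
have inj : set_inj [set: T] (@pickle T).
  by move=> x y _ _ /(pcan_inj pickleK).
transitivity (\esum_(k in [set pickle x | x in [set: T]]) oapp a 0%E (pickle_inv k))%E.
  rewrite [RHS]esum_mkcond; apply: eq_esum => k _.
  case: ifPn => // /negP nk; have := pickle_invK (T := T) k.
  case: pickle_inv => //= x xk; exfalso; apply: nk.
  by rewrite inE; exists x.
rewrite esum_image//; apply: eq_esum => x _.
by rewrite pickleK_inv.
Qed.

Lemma expR_mulrn (x : R) N : expR (x * N%:R) = expR x ^+ N.
Proof. by rewrite expRM powR_mulrn// expR_ge0. Qed.

Lemma geometric_small (c x e : R) : 0 <= x < 1 -> 0 < e -> 0 <= c ->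
  exists N0, forall N, (N0 <= N)%N -> c * x ^+ N <= e.
Proof.
move=> /andP[x0 x1] e0 c0.
have : x ^+ n @[n --> \oo] --> 0 by apply: cvg_expr; rewrite ger0_norm.
move=> /cvgrPdist_lt/(_ (e / (c + 1))).
rewrite divr_gt0// ?ltr_wpDl// => /(_ isT)[N0 _ h]; exists N0 => N /h.
rewrite sub0r normrN ger0_norm ?exprn_ge0// => /ltW hN.
apply: (le_trans (ler_wpM2l c0 hN)).
by rewrite mulrCA ger_pMr// ler_pdivrMr ?mul1r; lra.
Qed.

End Sums.

(** * Derivatives computed from inside the disk *)

Section Similarity.
Variable R : realType.
Local Notation E := 'rV[R]_2.

Lemma opnorm_similarity (A : E -> E) (c : R) : 0 <= c ->
  (forall v, enorm (A v) = c * enorm v) -> opnorm A = c.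
Proof.
move=> c0 Ac; apply/eqP; rewrite eq_le; apply/andP; split.
  apply: ge_sup; first by exists (enorm (A 0)), 0 => //=; rewrite enorm0.
  by move=> _ [v /= v1 <-]; rewrite Ac ler_piMr.
pose u : E := \row_(j < 2) (j == 0)%:R.
have u1 : enorm u = 1 by rewrite enorm2E !mxE /= expr1n expr0n addr0 sqrtr1.
apply: ub_le_sup; last by exists u; rewrite /= ?Ac u1// mulr1.
by exists c => _ [v /= v1 <-]; rewrite Ac ler_piMr.
Qed.

(** An extension is only known on the disk, so at boundary points only inward difference quotients
    are available. Since the differential is a similarity, one inward direction determines its
    ratio. *)
Lemma diff_norm_on_disk (f : E -> E) (x : E) (k : E -> R) :
  differentiable f x -> closed_disk x -> 0 < k x ->
  (forall y, closed_disk y -> 0 <= k y) ->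
  (forall v, k (h *: v + x) @[h --> 0^'+] --> k x) ->
  (forall y, closed_disk y ->
    enorm (f y - f x) = Num.sqrt (k y * k x) * enorm (y - x)) ->
  (exists2 r : R, 0 < r & forall v, enorm ('d f x v) = r * enorm v) ->
  forall v, enorm ('d f x v) = k x * enorm v.
Proof.
move=> df Dx kx0 k0 kc fk [r r0 dfr] v; rewrite dfr; congr (_ * _).
(* [u] points into the disk, so that the hypothesis on [f] applies along it *)
pose u : E := if x == 0 then \row_(j < 2) (j == 0)%:R else - x.
have u0 : enorm u != 0.
  rewrite enorm_eq0 /u; case: (eqVneq x 0) => [_|x0]; last by rewrite oppr_eq0.
  by apply/eqP => /rowP/(_ 0); rewrite !mxE /= => /eqP; rewrite oner_eq0.
have Du h : 0 < h < 1 -> closed_disk (h *: u + x).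
  move=> /andP[h0 h1]; rewrite closed_diskP /u; case: eqVneq => [->|x0].
    rewrite addr0 enormZ gtr0_norm// enorm2E !mxE /= expr1n expr0n addr0 sqrtr1; lra.
  rewrite scalerN -[X in _ + X]scale1r addrC -scalerBl enormZ gtr0_norm; last by lra.
  move/closed_diskP : Dx; have := enorm_ge0 x; nra.
have lim1 : enorm (h^-1 *: ((f \o shift x) (h *: u) - f x)) @[h --> 0^'+] --> r * enorm u.
  rewrite -dfr -deriveE//; apply: (@cvg_comp _ _ _ _ (@enorm R 2)); last first.
    exact: enorm_continuous.
  apply: cvg_dnbhs_at_right; exact: diff_derivable.
have lim2 : Num.sqrt (k (h *: u + x) * k x) * enorm u @[h --> 0^'+] -->
    Num.sqrt (k x * k x) * enorm u.
  apply: cvgM; last exact: cvg_cst.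
  apply: (@cvg_comp _ _ _ (fun h => k (h *: u + x) * k x) Num.sqrt); last exact: sqrt_continuous.
  by apply: cvgM; [exact: kc|exact: cvg_cst].
have : r * enorm u = Num.sqrt (k x * k x) * enorm u.
  rewrite -(cvg_lim (@norm_hausdorff _ _) lim1); apply: cvg_lim => //.
  apply: cvg_trans lim2; apply: near_eq_cvg.
  near=> h.
  have h01 : 0 < h < 1.
    by apply/andP; split; [near: h; exact: nbhs_right_gt|near: h; exact: nbhs_right_lt].
  have /andP[h0 _] := h01.
  have yx : h *: u + x - x = h *: u by rewrite addrK.
  have := fk _ (Du h h01); rewrite yx => fkh.
  rewrite enormZ /= fkh enormZ gtr0_norm ?invr_gt0// gtr0_norm//.
  by rewrite mulrCA mulKf// gt_eqF.
move/(mulIf u0) => ->; rewrite -expr2 sqrtr_sqr gtr0_norm//.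
Unshelve. all: by end_near. Qed.

End Similarity.

(** * Words of inversions: derivatives, distortion and covers *)

Section InversionSystem.
Variables (R : realType) (d : nat -> R).
Hypothesis d_spaced : spaced_seq d.
Local Notation E := 'rV[R]_2.
Local Notation I := (nat * 'I_4)%type.
Local Notation X := (@closed_disk R).
Local Notation G := (@G_family R d 4).
Hypothesis G_disk : forall p v, X v -> X (G p v).
Implicit Types (p : I) (w : seq I) (x y v : E).

Definition weight p x : R := (cnormsq d p x)^-1.

(** The chain rule product: the modulus of the derivative of [word_map G w] at [x]. *)
Fixpoint wweight w x : R :=
  if w is p :: w' then weight p (word_map G w' x) * wweight w' x else 1.

Lemma weight_gt0 p x : X x -> 0 < weight p x.
Proof. by move=> Xx; rewrite invr_gt0 (lt_le_trans ltr01)// cnormsq_ge1. Qed.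

Lemma word_map_disk w x : X x -> X (word_map G w x).
Proof. by move=> Xx; elim: w => //= p w; exact: G_disk. Qed.

Lemma wweight_gt0 w x : X x -> 0 < wweight w x.
Proof.
move=> Xx; elim: w => //= p w ih; apply: mulr_gt0 => //.
exact/weight_gt0/word_map_disk.
Qed.

Lemma word_dist w x y : X x -> X y ->
  enorm (word_map G w y - word_map G w x) =
  Num.sqrt (wweight w y * wweight w x) * enorm (y - x).
Proof.
move=> Xx Xy; elim: w => [|p w ih] /=; first by rewrite mul1r sqrtr1 mul1r.
rewrite G_family_dist; do ?by apply/(lt_le_trans ltr01)/cnormsq_ge1 => //; exact: word_map_disk.
rewrite ih mulrA -sqrtrM; last by rewrite mulr_ge0// ltW// weight_gt0//; exact: word_map_disk.
by congr (Num.sqrt _ * _); rewrite /weight; ring.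
Qed.

(** The largest derivative on the disk, reached at distance d_0 - 1 from a pole. *)
Definition max_weight : R := ((d 0%N - 1) ^+ 2)^-1.

Hypothesis d0_gt2 : 2 < d 0%N.

Lemma max_weight_gt0 : 0 < max_weight.
Proof. by have d0 := d0_gt2; rewrite invr_gt0 exprn_gt0//; lra. Qed.

Lemma max_weight_lt1 : max_weight < 1.
Proof.
have d0 := d0_gt2; rewrite invf_lt1 ?exprn_gt0 ?exprn_egt1//; lra.
Qed.

Lemma weight_le p x : X x -> weight p x <= max_weight.
Proof.
have d0 := d0_gt2.
move=> Xx; rewrite lef_pV2 ?posrE ?exprn_gt0//; last 2 first.
- by rewrite (lt_le_trans ltr01)// cnormsq_ge1.
- by lra.
apply: le_trans (cnormsq_ge d_spaced p Xx).
have := spaced_seq_ge d_spaced p.1 => d0p.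
by rewrite ler_pXn2r// ?nnegrE; lra.
Qed.

Lemma wweight_le w x : X x -> wweight w x <= max_weight ^+ size w.
Proof.
move=> Xx; elim: w => [|p w ih] //=; rewrite exprS; apply: ler_pM => //.
- by apply/ltW/weight_gt0/word_map_disk.
- by apply/ltW/wweight_gt0.
- exact/weight_le/word_map_disk.
Qed.

Lemma wweight_le1 w x : X x -> wweight w x <= 1.
Proof.
move=> Xx; apply: (le_trans (wweight_le w Xx)).
by rewrite exprn_ile1 ?ltW ?max_weight_gt0 ?max_weight_lt1.
Qed.

Lemma cnormsq_continuous p : continuous (cnormsq d p).
Proof.
move=> x; rewrite /cnormsq; move: (complex.Re _) (complex.Im _) => a b.
have c (i : 'I_2) k : {for x, continuous (fun y : E => (y 0 i + k) ^+ 2)}.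
  apply: (@continuous_comp _ _ _ (fun y : E => y 0 i) (fun t : R => (t + k) ^+ 2)).
    exact: coord_continuous.
  apply: (@continuous_comp _ _ _ (fun t : R => t + k) (fun t : R => t ^+ 2)); last first.
    exact: exprn_continuous.
  exact: (@continuousD _ _ _ id (fun=> k) _ (@cvg_id _ _) (@cst_continuous _ _ _ _)).
exact: (cvgD (c 0 a) (c 1 b)).
Qed.

Lemma weight_cvg p x v : X x -> weight p (h *: v + x) @[h --> 0^'+] --> weight p x.
Proof.
move=> Xx; apply: cvgV; first by rewrite gt_eqF// (lt_le_trans ltr01)// cnormsq_ge1.
apply: cvg_at_right_filter.
apply: (@cvg_comp _ _ _ (fun h : R => h *: v + x) (cnormsq d p)); last first.
  exact: cnormsq_continuous.
have : h *: v + x @[h --> (0 : R)] --> 0 *: v + x.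
  by apply: cvgD; [apply: cvgZr_tmp; exact: cvg_id|exact: cvg_cst].
by rewrite scale0r add0r.
Qed.

Section Extension.
Variables (V : set E) (e : I -> E -> E).
Hypotheses (ext : conformal_extension X G V e) (bd : bounded_distortion V e).

Let XV : X `<=` V. Proof. by case: ext => [[]]. Qed.
Let eG p x : X x -> e p x = G p x. Proof. by case: ext => _ + _ _ _; exact. Qed.
Let e_diff p x : X x -> differentiable (e p) x.
Proof.
by move=> /XV Vx; case: ext => _ _ _ [eps _ /(_ p)[[+ _] _ _]] _; apply.
Qed.
Let e_conf p x : X x -> exists2 r : R, 0 < r & forall v, enorm ('d (e p) x v) = r * enorm v.
Proof. by move=> /XV Vx; case: ext => _ _ _ _ /(_ p); apply. Qed.

Lemma diff_ext_norm p x v : X x -> enorm ('d (e p) x v) = weight p x * enorm v.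
Proof.
move=> Xx; move: v; apply: diff_norm_on_disk => //.
- exact: e_diff.
- exact: weight_gt0.
- by move=> y Xy; exact/ltW/weight_gt0.
- by move=> v; exact: weight_cvg.
- move=> y Xy; rewrite !eG// G_family_dist//;
    by apply/(lt_le_trans ltr01)/cnormsq_ge1.
- exact: e_conf.
Qed.

Lemma word_ext w x : X x -> [/\ word_map e w x = word_map G w x,
  differentiable (word_map e w) x &
  forall v, enorm ('d (word_map e w) x v) = wweight w x * enorm v].
Proof.
move=> Xx; elim: w => [|p w [e1 e2 e3]] /=.
  have idx := is_diff_id x.
  by split => // v; rewrite diff_val mul1r.
have Xw := word_map_disk w Xx.
split.
- by rewrite e1 eG.
- by apply: differentiable_comp => //; rewrite e1; exact: e_diff.
move=> v; rewrite diff_comp//; last by rewrite e1; exact: e_diff.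
by rewrite /= e1 diff_ext_norm// e3 mulrA.
Qed.

Lemma opnorm_word_ext w x : X x -> opnorm ('d (word_map e w) x) = wweight w x.
Proof.
move=> Xx; apply: opnorm_similarity; first exact/ltW/wweight_gt0.
by have [_ _] := word_ext w Xx.
Qed.

Lemma distortion : exists2 K : R, 1 <= K & forall w x y, X x -> X y ->
  wweight w y <= K * wweight w x.
Proof.
have [K K1 h] := bd; exists K => // w x y Xx Xy.
(* Bounded distortion leaves out the empty word, where both weights are 1. *)
case: w => [|p w]; first by rewrite /= mulr1.
rewrite -(opnorm_word_ext (p :: w) Xx) -(opnorm_word_ext (p :: w) Xy).
by apply: h => //; exact: XV.
Qed.

(** The partition function with the supremum replaced by one base point; bounded distortion makes
    the two comparable. *)
Definition weight_sum N (t : R) x : \bar R :=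
  \esum_(w in [set: N.-tuple I]) (wweight w x `^ t)%:E.

Lemma partition_function_ge N t : (weight_sum N t 0 <= partition_function X e N t)%E.
Proof.
apply: le_esum => w _; apply: ereal_sup_ubound; exists 0; first exact: closed_disk0.
by rewrite opnorm_word_ext//; exact: closed_disk0.
Qed.

Lemma partition_function_le (K : R) N t : 1 <= K ->
  (forall w x y, X x -> X y -> wweight w y <= K * wweight w x) -> 0 <= t ->
  (partition_function X e N t <= (K `^ t)%:E * weight_sum N t 0)%E.
Proof.
move=> K1 dist t0.
have K0 : 0 <= K by exact: le_trans K1.
have X0 := closed_disk0 R.
apply: le_trans (esum_cmul_le _ (powR_ge0 K t) _); last first.
  by move=> w; rewrite lee_fin powR_ge0.
apply: le_esum => w _; apply: ge_ereal_sup => _ [x Xx <-].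
have w0 z : X z -> 0 <= wweight w z by move=> Xz; exact/ltW/wweight_gt0.
rewrite opnorm_word_ext// -EFinM lee_fin -powRM ?w0//.
by apply: ge0_ler_powR; rewrite ?nnegrE ?mulr_ge0 ?w0//; exact: dist.
Qed.

End Extension.

(** The outermost letter is summed first: its weight is taken at [word_map G w x], again a point of
    the disk, so the uniform bound [q] applies. *)
Lemma weight_sum_exp t q : 0 <= q ->
  (forall x, X x -> (\esum_(p in [set: I]) (weight p x `^ t)%:E <= q%:E)%E) ->
  forall N x, X x -> (weight_sum N t x <= (q ^+ N)%:E)%E.
Proof.
move=> q0 hq; elim=> [|N ih] x Xx.
  rewrite /weight_sum (_ : [set: 0.-tuple I] = [set [tuple]]).
    by rewrite esum_set1 ?lee_fin ?powR_ge0//= powR1.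
  by apply/seteqP; split => // w _; exact: (tuple0 w).
pose cons (k : N.-tuple I * I) : N.+1.-tuple I := [tuple of k.2 :: k.1].
rewrite /weight_sum (@reindex_esum _ _ _ [set: N.-tuple I * I] _ cons); last first.
  split => // [[w p] [w' p'] _ _ /(congr1 val) /= [-> ww]|w _].
    by congr (_, _); exact/val_inj.
  by exists ([tuple of behead w], thead w) => //; rewrite /cons -tuple_eta.
have -> : (\esum_(k in [set: N.-tuple I * I]) (wweight (cons k) x `^ t)%:E =
    \esum_(w in [set: N.-tuple I]) \esum_(p in [set: I]) (wweight (p :: w) x `^ t)%:E)%E.
  rewrite esum_esum; last by move=> *; rewrite lee_fin powR_ge0.
  by congr esum; apply/seteqP; split.
have w0 (w : seq I) : 0 <= wweight w x by exact/ltW/wweight_gt0.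
apply: (@le_trans _ _ (\esum_(w in [set: N.-tuple I]) (q%:E * (wweight w x `^ t)%:E))%E).
  apply: le_esum => w _.
  apply: (@le_trans _ _ (\esum_(p in [set: I])
      ((wweight w x `^ t)%:E * (weight p (word_map G w x) `^ t)%:E))%E).
    apply: le_esum => p _; rewrite -EFinM lee_fin /= mulrC powRM ?w0//.
    exact/ltW/weight_gt0/word_map_disk.
  apply: le_trans (esum_cmul_le _ (powR_ge0 _ _) _) _.
    by move=> p; rewrite lee_fin powR_ge0.
  rewrite muleC lee_wpmul2r ?lee_fin ?powR_ge0//.
  exact/hq/word_map_disk.
apply: le_trans (esum_cmul_le _ q0 _) _; first by move=> w; rewrite lee_fin powR_ge0.
by rewrite exprS EFinM lee_wpmul2l ?lee_fin//; exact: ih.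
Qed.

Lemma weight_sum_anti N s t x : X x -> s <= t -> (weight_sum N t x <= weight_sum N s x)%E.
Proof.
move=> Xx st; apply: le_esum => w _; rewrite lee_fin; apply: ger_powR => //.
by rewrite wweight_gt0// wweight_le1.
Qed.

(** The images of the disk under words of length N have diameter at most 2K times the weight at 0.
    Raising the exponent from [t0] to [t] gains a factor exponentially small in N, which beats the
    subexponential growth at [t0]. *)
Lemma limit_set_dim_le (K t0 t : R) : 1 <= K -> 0 <= t0 -> t0 < t ->
  (forall w x y, X x -> X y -> wweight w y <= K * wweight w x) ->
  (forall eps, 0 < eps -> exists N0, forall N, (N0 <= N)%N ->
     (weight_sum N t0 0 <= (expR (eps * N%:R))%:E)%E) ->
  (hausdorff_dim (limit_set X G) <= t%:E)%E.
Proof.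
move=> K1 t00 t0t dist sum_le.
have t_ge0 : 0 <= t by exact: le_trans (ltW t0t).
have X0 := closed_disk0 R.
have K0 : 0 < K by exact: lt_le_trans K1.
apply: hausdorff_dim_le => // eps delta eps0 delta0.
pose k := max_weight `^ (t - t0).
have k0 : 0 < k by rewrite powR_gt0 ?max_weight_gt0.
have k1 : k < 1.
  rewrite /k /powR gt_eqF ?max_weight_gt0// -expR0 ltr_expR.
  by rewrite pmulr_rlt0 ?subr_gt0// ln_lt0// max_weight_gt0 max_weight_lt1.
(* Half the decay rate, so that [k * expR g] is the square root of [k]. *)
pose g := - ln k / 2.
have g0 : 0 < g by rewrite divr_gt0// oppr_gt0 ln_lt0// k0.
have kg0 : 0 <= k * expR g < 1.
  rewrite mulr_ge0 ?expR_ge0 ?ltW//= -[k in k * _]lnK ?posrE// -expRD -expR0 ltr_expR.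
  rewrite /g; have : ln k < 0 by rewrite ln_lt0// k0.
  lra.
have [N1 hN1] := sum_le g g0.
have [N2 hN2] := geometric_small kg0 eps0 (powR_ge0 (2 * K) t).
have rho01 : 0 <= max_weight < 1 by rewrite ltW ?max_weight_gt0 ?max_weight_lt1.
have [N3 hN3] := @geometric_small _ (2 * K) _ _ rho01 delta0 (mulr_ge0 (ler0n _ _) (ltW K0)).
(* The successor makes [N] positive: [limit_set] only constrains positive lengths. *)
pose N := (maxn (maxn N1 N2) N3).+1.
have N_1 : (N1 <= N)%N by apply/leqW; rewrite !leq_max leqnn ?orbT.
have N_2 : (N2 <= N)%N by apply/leqW; rewrite !leq_max leqnn ?orbT.
have N_3 : (N3 <= N)%N by apply/leqW; rewrite !leq_max leqnn ?orbT.
pose U n : set E := oapp (fun w : N.-tuple I => word_map G w @` X) set0 (pickle_inv n).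
have diamU (w : seq I) : (diam (word_map G w @` X) <= (2 * K * wweight w 0)%:E)%E.
  apply: ge_ereal_sup => _ [[_ _] [[x Xx <-] [y Xy <-]] <-] /=.
  have w0 := wweight_gt0 w X0.
  have wx := wweight_gt0 w Xx; have wy := wweight_gt0 w Xy.
  rewrite lee_fin word_dist// -mulrA mulrC.
  apply: ler_pM; rewrite ?sqrtr_ge0 ?enorm_ge0//; first exact: closed_disk_dist.
  have Kw0 : 0 <= K * wweight w 0 by rewrite mulr_ge0// ltW.
  rewrite -[leRHS](ger0_norm Kw0) -sqrtr_sqr ler_wsqrtr// expr2.
  by apply: ler_pM; rewrite ?(ltW wx) ?(ltW wy)//; exact: dist.
have small (w : N.-tuple I) : 2 * K * wweight w 0 <= 2 * K * max_weight ^+ N.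
  have := wweight_le w X0; rewrite size_tuple => h.
  by rewrite ler_wpM2l// mulr_ge0// ltW.
have gaugeU n : (hausdorff_gauge t (U n) <=
    oapp (fun w : N.-tuple I => ((2 * K * wweight w 0) `^ t)%:E) 0 (pickle_inv n))%E.
  rewrite /U; case: pickle_inv => [w|] /=; last by rewrite /hausdorff_gauge eqxx.
  have ne : word_map G w @` X !=set0 by exists (word_map G w 0), 0.
  rewrite /hausdorff_gauge ifF; last exact/negbTE/set0P.
  have := diamU w; have := diam_ge0 ne; case: (diam _) => [D||]//=.
  rewrite !lee_fin => D0 D1; apply: ge0_ler_powR; rewrite ?nnegrE//.
  by rewrite !mulr_ge0 ?(ltW K0)// ltW// wweight_gt0.
exists U; split.
- move=> z [om _ omz].
  have [x Xx <-] := omz N isT.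
  exists (pickle [tuple of mkseq om N]) => //.
  by rewrite /U pickleK_inv /=; exists x.
- move=> n; rewrite /U; case: pickle_inv => [w|] /=.
    by apply: (le_trans (diamU w)); rewrite lee_fin; apply: le_trans (small w) _; exact: hN3.
  apply: ge_ereal_sup => _ [[u v] [] []].
apply: le_trans (lee_nneseries (fun n _ _ => hausdorff_gauge_ge0 _ _) (fun n _ => gaugeU n)) _.
rewrite nneseries_pickle_inv; last by move=> w; rewrite lee_fin powR_ge0.
pose c := (2 * K) `^ t * k ^+ N.
have c0 : 0 <= c by rewrite mulr_ge0 ?powR_ge0 ?exprn_ge0// ltW.
apply: (@le_trans _ _ (\esum_(w in [set: N.-tuple I]) (c%:E * (wweight w 0 `^ t0)%:E))%E).
  apply: le_esum => w _; rewrite -EFinM lee_fin /c.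
  have w0 := wweight_gt0 w X0.
  rewrite powRM ?(ltW w0) ?mulr_ge0 ?(ltW K0)// -mulrA ler_wpM2l ?powR_ge0//.
  rewrite -{1}(subrK t0 t) powRD; last by apply/implyP => _; rewrite lt0r_neq0.
  rewrite ler_wpM2r ?powR_ge0//.
  have -> : k ^+ N = (max_weight ^+ N) `^ (t - t0).
    by rewrite -!powR_mulrn ?(ltW k0) ?(ltW max_weight_gt0)// /k powRAC.
  apply: ge0_ler_powR; rewrite ?nnegrE ?(ltW w0) ?exprn_ge0 ?(ltW max_weight_gt0)//.
    by rewrite subr_ge0 ltW.
  by have := wweight_le w X0; rewrite size_tuple.
apply: le_trans (esum_cmul_le _ c0 _) _; first by move=> w; rewrite lee_fin powR_ge0.
apply: (@le_trans _ _ (c%:E * (expR (g * N%:R))%:E)%E).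
  by rewrite lee_wpmul2l ?lee_fin//; exact: hN1.
rewrite -EFinM lee_fin /c expR_mulrn -mulrA -exprMn; exact: hN2.
Qed.

End InversionSystem.

(** * Zero pressure, one-letter sums and strict contraction *)

Section WeightSums.
Variable R : realType.

Lemma esum_fintype (T : finType) (a : T -> \bar R) : (forall i, 0 <= a i)%E ->
  (\esum_(i in [set: T]) a i = \sum_i a i)%E.
Proof.
move=> a0; rewrite esum_fset//; last exact: finite_finset.
rewrite (fsbigE (enum T)) ?enum_uniq//; last by move=> i _; rewrite mem_enum.
rewrite (eq_bigl xpredT) ?big_enum// => i; exact: in_setT.
Qed.

Lemma nneseries_le (a : nat -> \bar R) (x : \bar R) : (forall n, 0 <= a n)%E ->
  (forall n, \sum_(0 <= k < n) a k <= x)%E -> (\sum_(0 <= k <oo) a k <= x)%E.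
Proof.
move=> a0 h; apply: lime_le; last exact: nearW.
by apply: is_cvg_nneseries => n _ _; exact: a0.
Qed.

Lemma ereal_lim0_bounds (u : nat -> \bar R) (eps : R) : 0 < eps -> u n @[n --> \oo] --> 0%E ->
  exists N0, forall N, (N0 <= N)%N -> exists2 x, u N = x%:E & - eps < x < eps.
Proof.
move=> eps0 /fine_cvgP[[N1 _ h1] /cvgrPdist_lt/(_ eps eps0)[N2 _ h2]].
exists (maxn N1 N2) => N; rewrite geq_max => /andP[/h1 fin /h2 /=].
rewrite sub0r normrN ltr_norml => h; exists (fine (u N)) => //.
by rewrite fineK.
Qed.

(** A finite scaled logarithm rules out nonpositive and infinite [Z]; this needs [0 < N], as the
    factor would otherwise be 0. *)
Lemma lne_scaled_bounds (Z : \bar R) (N : nat) (x eps : R) : (0 < N)%N ->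
  ((N%:R^-1)%:E * lne Z = x%:E)%E -> - eps < x < eps ->
  ((expR (- eps * N%:R))%:E <= Z)%E /\ (Z <= (expR (eps * N%:R))%:E)%E.
Proof.
move=> N0; have Np : 0 < N%:R :> R by rewrite ltr0n.
have Ni : 0 < N%:R^-1 :> R by rewrite invr_gt0.
case: Z => [z| |] /=.
- case: ifPn => [_|]; first by rewrite gt0_muleNy ?lte_fin.
  rewrite -ltNge => z0 [] <- /andP[h1 h2].
  rewrite !lee_fin -[in X in _ <= X /\ _](lnK z0) -[in X in _ /\ X <= _](lnK z0) !ler_expR.
  rewrite mulrC ltr_pdivrMr// in h2; rewrite mulrC ltr_pdivlMr// in h1.
  by split; exact: ltW.
- by rewrite gt0_muley ?lte_fin.
- by rewrite gt0_muleNy ?lte_fin.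
Qed.

Lemma pressure_zero_bounds (I : countType) (X : set 'rV[R]_2) (e : I -> 'rV[R]_2 -> 'rV[R]_2)
    (t eps : R) : 0 < eps -> pressure_is X e t 0%E ->
  exists N0, forall N, (N0 <= N)%N ->
    ((expR (- eps * N%:R))%:E <= partition_function X e N t)%E /\
    (partition_function X e N t <= (expR (eps * N%:R))%:E)%E.
Proof.
move=> eps0 /(ereal_lim0_bounds eps0)[N0 h]; exists N0.+1 => N NN.
have [x xE xeps] := h N (ltnW NN).
exact: lne_scaled_bounds (leq_trans (ltn0Sn _) NN) xE xeps.
Qed.

Variable d : nat -> R.
Hypothesis d_spaced : spaced_seq d.
Local Notation X := (@closed_disk R).
Local Notation I := (nat * 'I_4)%type.

Lemma sum4_weight_le t n x : 0 < t -> t < 1 -> threshold t <= d n -> X x ->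
  \sum_(j < 4) weight d (n, j) x `^ t <= (4 - gap (d n) t) * ratio d n `^ t.
Proof.
move=> t0 t1 dn /closed_diskE xx.
have := four_derivatives_le (spaced_seq_ge2 d_spaced n) xx t0 t1 dn.
rewrite -/(ratio d n); apply: le_trans; apply: ler_sum => j _.
rewrite /weight cnormsq_distsq /=.
by case: (nat_of_ord j) => [|[|[|k]]].
Qed.

(** Keeping only the gap of the first index bounds the whole sum by [1 - g], uniformly in the
    point. *)
Lemma sum_weight_lt1 t : 0 < t -> t < 1 -> threshold t <= d 0%N ->
  (forall M, \sum_(n < M) 4 * ratio d n `^ t <= 1) ->
  exists2 q, 0 < q < 1 & forall x, X x ->
    (\esum_(p in [set: I]) (weight d p x `^ t)%:E <= q%:E)%E.
Proof.
move=> t0 t1 dt small.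
pose g := gap (d 0%N) t * ratio d 0 `^ t.
have g0 : 0 < g.
  by rewrite mulr_gt0 ?powR_gt0 ?ratio_gt0// gap_gt0// spaced_seq_ge2.
(* The maximum with 1/2 keeps [q] positive. *)
exists (Num.max 2^-1 (1 - g)).
  by rewrite lt_max invr_gt0 ltr0n/= gt_max; apply/andP; split; lra.
move=> x Xx.
have w0 (p : I) : (0 <= (weight d p x `^ t)%:E)%E by rewrite lee_fin powR_ge0.
have -> : (\esum_(p in [set: I]) (weight d p x `^ t)%:E =
    \esum_(n in [set: nat]) \esum_(j in [set: 'I_4]) (weight d (n, j) x `^ t)%:E)%E.
  rewrite esum_esum//; transitivity (\esum_(p in [set: nat] `*`` (fun=> [set: 'I_4]))
    (weight d p x `^ t)%:E)%E; first by congr esum; apply/seteqP; split.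
  by apply: eq_esum => -[].
rewrite -nneseries_esumT; last by move=> n; exact: esum_ge0.
apply: nneseries_le => [n|M]; first exact: esum_ge0.
apply: (@le_trans _ _ (\sum_(0 <= n < M)
    (4 * ratio d n `^ t - (if n == 0%N then g else 0))%:E)%E).
  apply: lee_sum => n _; rewrite esum_fintype// sumEFin lee_fin.
  apply: le_trans (sum4_weight_le t0 t1 _ Xx) _.
    exact: le_trans (spaced_seq_ge d_spaced n).
  rewrite mulrBl lerD2l lerN2; case: eqVneq => [->//|_].
  by rewrite mulr_ge0 ?powR_ge0// ltW// gap_gt0// spaced_seq_ge2.
rewrite sumEFin lee_fin le_max; case: M => [|M].
  by rewrite big_geq// invr_ge0 ler0n.
apply/orP; right; rewrite sumrB lerB//.
  by have := small M.+1; rewrite big_mkord.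
by rewrite big_mkord big_ord_recl /= lerDl sumr_ge0.
Qed.

Lemma powR_sum_continuous M t : 1 < \sum_(n < M) 4 * ratio d n `^ t ->
  exists2 s, t < s & 1 <= \sum_(n < M) 4 * ratio d n `^ s.
Proof.
move=> h; pose f (s : R) := \sum_(n < M) 4 * ratio d n `^ s.
have fc : f s @[s --> t] --> f t.
  apply: cvg_big => [|n _]; [exact: add_continuous|]; apply: cvgM; first exact: cvg_cst.
  rewrite /powR gt_eqF ?ratio_gt0//.
  apply: (@cvg_comp _ _ _ (fun s : R => s * ln (ratio d n)) expR); last exact: continuous_expR.
  by apply: cvgMr_tmp; exact: cvg_id.
have : \forall s \near t, 1 < f s by exact: (cvgr_gt (f t) fc 1 h).
move=> /nbhs_ballP[r /= r0 hr]; exists (t + r / 2); first by rewrite ltrDl divr_gt0.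
apply/ltW/hr; rewrite /ball /= opprD addrA subrr sub0r normrN gtr0_norm ?divr_gt0//; lra.
Qed.

(** For d_0 = 2 the map 1/(z + 2) has derivative of modulus 1 at -1, so no uniform contraction ratio
    below 1 is possible. *)
Lemma G_IFS_gt2 : is_IFS X (@G_family R d 4) -> 2 < d 0%N.
Proof.
move=> [_ _ _ _]; set S := ereal_sup _ => S1.
rewrite lt_neqAle d_spaced.1 andbT; apply/eqP => /esym d2.
pose p0 : I := (0%N, ord0).
(* Real points at distance [a] from -1; between [x a] and [x 0] distances are scaled by 1/(1 +
   a). *)
pose x (a : R) : 'rV[R]_2 := \row_(j < 2) (if j == 0 then a - 1 else 0).
have xE a : (x a 0 0 = a - 1) * (x a 0 1 = 0) by rewrite !mxE.
have Dx a : 0 <= a <= 1 -> X (x a).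
  by move=> /andP[a0 a1]; rewrite closed_diskE !xE; nra.
have cx a : cnormsq d p0 (x a) = (1 + a) ^+ 2.
  by rewrite cnormsq_distsq /= !xE d2; ring.
have Sge a : 0 < a <= 1 -> (((1 + a)^-1)%:E <= S)%E.
  move=> /andP[a0 a1].
  apply: (@le_trans _ _ (Lip X (@G_family R d 4 p0))); last first.
    by apply: ereal_sup_ubound; exists p0.
  apply: le_ereal_sup_tmp.
  have xx : x a - x 0 != 0.
    apply/eqP => /rowP/(_ 0); rewrite !mxE /= => /eqP; rewrite opprB addrA subrK subr0.
    by rewrite gt_eqF.
  eexists; first (exists (x a, x 0) => //=; split; first by apply: Dx; lra).
  - by apply: Dx; lra.
  - by move=> e; move: xx; rewrite e subrr eqxx.
  rewrite lee_fin G_family_dist !cx; try by rewrite exprn_gt0//; lra.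
  rewrite mulfK ?enorm_eq0// addr0 expr1n invr1 mulr1 -exprVn sqrtr_sqr.
  by rewrite ger0_norm// invr_ge0; lra.
have := Sge 1; rewrite ltr01 lexx => /(_ isT).
case: S S1 Sge => [L||]//; rewrite !lte_fin => L1 Sge h1.
have L0 : 0 < L by rewrite -lte_fin; apply: lt_le_trans h1; rewrite lte_fin invr_gt0; lra.
(* For this [a], (1 + a) L < 1 amounts to (1 - L)(2 - L) > 0. *)
have a01 : 0 < (1 - L) / 2 <= 1 by apply/andP; split; lra.
have := Sge _ a01; rewrite lee_fin invf_ple ?posrE//; last by lra.
have : (1 + (1 - L) / 2) * L < 1 by nra.
by rewrite -ltr_pdivlMr// mul1r => /lt_le_trans h /h; rewrite ltxx.
Qed.

End WeightSums.

(** * The threshold and the comparison of dimensions *)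

Lemma threshold_mono (R : realType) (t u : R) : 0 < t -> t <= u -> u < 1 ->
  threshold t <= threshold u.
Proof.
move=> t0 tu u1; rewrite /threshold; case: (leP t) => ht; case: (leP u) => hu //.
- by rewrite ler_pdivlMr; lra.
- lra.
- by rewrite ler_pM2l// lef_pV2 ?posrE; lra.
Qed.

Lemma threshold_ge2 (R : realType) (t : R) : 0 < t -> t < 1 -> 2 <= threshold t.
Proof.
by move=> t0 t1; rewrite /threshold; case: (leP t) => ht //; rewrite ler_pdivlMr; lra.
Qed.

Lemma ratio_sum_gt1 (R : realType) (d : nat -> R) (h : R) :
  spaced_seq d -> is_CIFS (@closed_disk R) (@G_family R d 4) ->
  is_regular (@closed_disk R) (@G_family R d 4) ->
  hausdorff_dim (limit_set (@closed_disk R) (@G_family R d 4)) = h%:E ->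
  0 < h -> h < 1 -> threshold h <= d 0%N ->
  exists M, 1 < \sum_(n < M) 4 * ratio d n `^ h.
Proof.
move=> d_spaced [IFS _ _ _] [V [e [ext bd [t0 t00 P0]]]] dimh h0 h1 dh.
apply: contrapT => /forallNP no.
have small M : \sum_(n < M) 4 * ratio d n `^ h <= 1 by rewrite leNgt; exact/negP.
have d02 := G_IFS_gt2 d_spaced IFS.
have G_disk (p : nat * 'I_4) v : closed_disk v -> closed_disk (G_family d p v).
  by move=> v1; have [_ _ _ GD _] := IFS; have [sub _] := GD p; apply: sub; exists v.
have [K K1 dist] := distortion d_spaced G_disk ext bd.
have X0 := closed_disk0 R.
(* A pressure zero below [h] would bound the dimension by the midpoint of [t0] and [h]. *)
have [t0h|ht0] := ltP t0 h.
  have tm : t0 < (t0 + h) / 2 by lra.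
  have : (hausdorff_dim (limit_set (@closed_disk R) (@G_family R d 4)) <= ((t0 + h) / 2)%:E)%E.
    apply: (limit_set_dim_le d_spaced G_disk d02 K1 t00 tm dist) => eps eps0.
    have [N0 hN] := pressure_zero_bounds eps0 P0; exists N0 => N /hN[_]; apply: le_trans.
    exact: (partition_function_ge d_spaced G_disk ext N t0).
  by rewrite dimh lee_fin; lra.
(* For [h <= t0] the sums at [t0] are at most those at [h], hence at most q^N, while zero pressure
   forbids exponential decay. *)
have [q /andP[q0 q1] hq] := sum_weight_lt1 d_spaced h0 h1 dh small.
pose g := - ln q / 2.
have lq : ln q < 0 by rewrite ln_lt0// q0.
have g0 : 0 < g by rewrite /g; lra.
have qg : 0 <= q * expR g < 1.
  rewrite mulr_ge0 ?expR_ge0 ?(ltW q0)//= -[q in q * _]lnK ?posrE// -expRD -expR0 ltr_expR.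
  by rewrite /g; lra.
have [N1 hN1] := pressure_zero_bounds g0 P0.
have half0 : 0 < 2^-1 :> R by rewrite invr_gt0.
have [N2 hN2] := geometric_small qg half0 (powR_ge0 K t0).
pose N := maxn N1 N2.
have [lo _] := hN1 N (leq_maxl _ _); have := hN2 N (leq_maxr _ _).
have : ((expR (- g * N%:R))%:E <= (K `^ t0 * q ^+ N)%:E)%E.
  apply: (le_trans lo); apply: le_trans (partition_function_le d_spaced G_disk ext N K1 dist t00) _.
  rewrite EFinM lee_wpmul2l ?lee_fin ?powR_ge0//.
  apply: le_trans (weight_sum_anti d_spaced G_disk d02 N X0 ht0) _.
  by apply: weight_sum_exp => //; exact: ltW.
rewrite lee_fin mulNr expRN expR_mulrn => a1.
rewrite exprMn mulrA => a2.
have : 1 <= K `^ t0 * q ^+ N * expR g ^+ N.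
  by rewrite -ler_pdivrMr ?exprn_gt0 ?expR_gt0// mul1r.
by lra.
Qed.

Theorem theorem6 (R : realType) :
  exists L : R -> R,
    [/\ (forall t : R, 0 < t -> t < 1 -> 2 <= L t),
        (forall t u : R, 0 < t -> t <= u -> u < 1 -> L t <= L u),
        (forall t : R, 0 < t -> t <= 1 / 2 -> L t = 2) &
        (forall d : nat -> R,
           spaced_seq d ->
           let X := @closed_disk R in
           let F := @F_family R d 4 in
           let G := @G_family R d 4 in
           is_CIFS X F ->
           is_CIFS X G -> is_regular X G ->
           forall h : R,
             hausdorff_dim (limit_set X G) = h%:E ->
             0 < h -> h < 1 ->
             L h <= d 0%N ->
             (hausdorff_dim (limit_set X G) < hausdorff_dim (limit_set X F))%E)].
Proof.
exists (@threshold R); split.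
- exact: threshold_ge2.
- exact: threshold_mono.
- by move=> t _ t1; rewrite /threshold t1.
move=> d d_spaced X F G F_CIFS G_CIFS G_reg h dimh h0 h1 dh.
have [M hM] := ratio_sum_gt1 d_spaced G_CIFS G_reg dimh h0 h1 dh.
have [s hs sM] := powR_sum_continuous d_spaced hM.
rewrite dimh; apply: (@lt_le_trans _ _ s%:E); first by rewrite lte_fin.
exact: (F_family_dim_ge d_spaced F_CIFS (lt_trans h0 hs) sM).
Qed.
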